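(* Let $q=2^n$ with $n\ge 1$ and suppose $E/\mathbb{F}_q$ is an elliptic curve. Then $$\#\mathrm{Twist}(E/\mathbb{F}_q)=\begin{cases}2 & \text{if } j(E)\neq 0,\\ 3 & \text{if } j(E)=0 \text{ and } n \text{ is odd},\\ 7 & \text{if } j(E)=0\text{ and } n\text{ is even}.\end{cases}$$
   Context: For an elliptic curve $E$ over a perfect field $K$ with fixed separable closure $\overline{K}$, a twist of $E$ is an elliptic curve $E^{\mathrm{tw}}/K$ that is isomorphic to $E$ over $\overline{K}$ (as elliptic curves). Two twists are considered equal if they are isomorphic over $K$. $\mathrm{Twist}(E/K)$ denotes the set of twists of $E$ (including the trivial one, $E$ itself). *)

(* Defs.v *)
From HB Require Import structures.
From mathcomp Require Import all_boot all_order all_algebra all_field.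
From mathcomp Require Import mpoly.
From mathcomp Require Import boolp classical_sets functions cardinality.

Set Implicit Arguments.
Unset Strict Implicit.
Unset Printing Implicit Defensive.

Import GRing.Theory.
Local Open Scope ring_scope.

(* The projective curve
     Y^2 Z + a1 XYZ + a3 YZ^2 = X^3 + a2 X^2 Z + a4 XZ^2 + a6 Z^3. *)
Record weierstrass (K : fieldType) := Weierstrass {
  a1 : K; a2 : K; a3 : K; a4 : K; a6 : K }.

Section Invariants.
Variables (K : fieldType) (W : weierstrass K).

Definition b2 : K := a1 W ^+ 2 + 4 * a2 W.
Definition b4 : K := 2 * a4 W + a1 W * a3 W.
Definition b6 : K := a3 W ^+ 2 + 4 * a6 W.
Definition b8 : K :=
  a1 W ^+ 2 * a6 W + 4 * a2 W * a6 W - a1 W * a3 W * a4 W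
  + a2 W * a3 W ^+ 2 - a4 W ^+ 2.
Definition c4 : K := b2 ^+ 2 - 24 * b4.
Definition disc : K :=
  - b2 ^+ 2 * b8 - 8 * b4 ^+ 3 - 27 * b6 ^+ 2 + 9 * b2 * b4 * b6.

End Invariants.

(* The base point is O = [0 : 1 : 0]; smoothness is the non-vanishing of the
   discriminant. *)
Record elliptic_curve (K : fieldType) := EllipticCurve {
  model :> weierstrass K;
  disc_neq0 : disc model != 0 }.

Definition j_invariant (K : fieldType) (E : elliptic_curve K) : K :=
  c4 E ^+ 3 / disc E.

Section BaseChange.
Variables (K L : fieldType) (iota : {rmorphism K -> L}).

Definition map_weierstrass (W : weierstrass K) : weierstrass L :=
  Weierstrass (iota (a1 W)) (iota (a2 W)) (iota (a3 W)) (iota (a4 W))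
              (iota (a6 W)).

Lemma disc_map (W : weierstrass K) : disc (map_weierstrass W) = iota (disc W).
Proof.
rewrite /disc /b2 /b4 /b6 /b8 /=.
by rewrite !(rmorph_nat, rmorphXn, rmorphN, rmorphB, rmorphM, rmorphD).
Qed.

Lemma disc_map_neq0 (E : elliptic_curve K) : disc (map_weierstrass E) != 0.
Proof. by rewrite disc_map fmorph_eq0 disc_neq0. Qed.

Definition base_change (E : elliptic_curve K) : elliptic_curve L :=
  EllipticCurve (disc_map_neq0 E).

End BaseChange.

Definition separable_closure (K L : fieldType) (iota : {rmorphism K -> L}) :=
  (forall x : L, exists2 p : {poly K},
     separable_poly p & root (map_poly iota p) x) /\
  (forall p : {poly L}, separable_poly p -> (1 < size p)%N ->
     exists x, root p x).

(* Points of the projective plane over L are represented by nonzero vectors of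
   homogeneous coordinates (X, Y, Z), up to proportionality. *)
Definition proj_eq (L : fieldType) (P Q : 'rV[L]_3) : Prop :=
  exists2 c : L, c != 0 & P = c *: Q.

Definition cX : 'I_3 := @Ordinal 3 0 isT.
Definition cY : 'I_3 := @Ordinal 3 1 isT.
Definition cZ : 'I_3 := @Ordinal 3 2 isT.

Definition on_curve (L : fieldType) (W : weierstrass L) (P : 'rV[L]_3) : Prop :=
  let X := P 0 cX in let Y := P 0 cY in let Z := P 0 cZ in
  P != 0 /\
  Y ^+ 2 * Z + a1 W * X * Y * Z + a3 W * Y * Z ^+ 2
  = X ^+ 3 + a2 W * X ^+ 2 * Z + a4 W * X * Z ^+ 2 + a6 W * Z ^+ 3.

Definition origin (L : fieldType) : 'rV[L]_3 := delta_mx 0 cY.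

Section Morphisms.
Variables (K L : fieldType) (iota : {rmorphism K -> L}).

Definition eval_triple (phi : 'I_3 -> {mpoly K[3]}) (P : 'rV[L]_3) : 'rV[L]_3 :=
  \row_i (map_mpoly iota (phi i)).@[fun k => P 0 k].

(* Morphisms of projective curves E -> E' defined over K, for K perfect
   and L a separable (hence algebraic) closure of K: maps on L-points that,
   in a Zariski neighbourhood of every point, are given by three homogeneous
   polynomials of the same degree with coefficients in K.
   Only the values of f on (representatives of) points of E matter, and the
   last clause makes f compatible with proportionality. *)
Definition curve_morphism (E E' : elliptic_curve K)
    (f : 'rV[L]_3 -> 'rV[L]_3) : Prop :=
  (forall P, on_curve (base_change iota E) P ->
     on_curve (base_change iota E') (f P)) /\
  (forall P, on_curve (base_change iota E) P ->
     exists (d : nat) (phi : 'I_3 -> {mpoly K[3]}),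
       [/\ forall i, phi i \is d.-homog,
           eval_triple phi P != 0
         & forall Q, on_curve (base_change iota E) Q ->
             eval_triple phi Q != 0 -> proj_eq (f Q) (eval_triple phi Q)]).

(* Isomorphisms over K of elliptic curves: isomorphisms of varieties preserving
   the base point. *)
Definition isomorphic (E E' : elliptic_curve K) : Prop :=
  exists f g : 'rV[L]_3 -> 'rV[L]_3,
    [/\ curve_morphism E E' f,
        curve_morphism E' E g,
        forall P, on_curve (base_change iota E) P -> proj_eq (g (f P)) P,
        forall P, on_curve (base_change iota E') P -> proj_eq (f (g P)) P
      & proj_eq (f (origin L)) (origin L)].

End Morphisms.

Section Twists.
Variables (K Kbar : fieldType) (iota : {rmorphism K -> Kbar}).

Definition is_twist (E E' : elliptic_curve K) : Prop :=
  isomorphic (idfun : {rmorphism Kbar -> Kbar})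
    (base_change iota E) (base_change iota E').

Local Open Scope classical_set_scope.

(* The set of twists of E, where K-isomorphic twists are identified: its
   elements are the K-isomorphism classes of twists. *)
Definition Twist (E : elliptic_curve K) : set (set (elliptic_curve K)) :=
  [set isomorphic iota E' | E' in is_twist E].

End Twists.

(* Main.v *)
Require Import Defs.
From mathcomp Require Import all_boot all_order all_algebra all_field.
From mathcomp Require Import cyclic mpoly ring zify.
From mathcomp Require Import classical_sets functions cardinality.

(** An isomorphism of elliptic curves is a change of Weierstrass coordinates
    x = u^2 x' + r, y = u^3 y' + s u^2 x' + t ([isomorphicP]), so twists are
    Weierstrass equations up to these explicit changes, and they can be counted
    by reducing the equations to normal form.

    To see that an isomorphism f has this shape, note that it preserves the
    origin, so its affine coordinates al and be are functions on the affine
    curve given locally by fractions.  A norm argument shows that such functions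
    have the form a(x) + b(x) y ([regular_local]).  The degree of the norm is the
    order of the pole at the origin: 2 for x, 3 for y.  The equation of the
    target forces al and be to have pole orders 2m and 3m, so all polynomials in
    al and be have pole orders divisible by m; since the inverse of f writes x and y
    as such polynomials, m = 1 ([pole_al3_be4]).  Thus al is affine in x, be is
    affine in x and y, and comparing the equations gives the claim
    ([affine_iso_change]).  This uses points over an algebraically closed
    field, which a separable closure of a finite field is
    ([separable_closure_closed]).

    In characteristic two, j = a1^12 / disc, so j vanishes exactly when a1 does.

    If a1 is nonzero, the equation becomes y^2 + x y = x^3 + a x^2 + b.  Here b is
    an invariant over the closure, a can be shifted there at will, and over F it is
    determined modulo the values of s^2 + s, which form a subgroup of index 2.

    If a1 = 0, the equation becomes y^2 + a y = x^3 + b x + c, all of these are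
    equivalent over the closure, and over F the changes left act by
    a = u^3 a', u^4 b' = b + s^4 + a s, u^6 c' = c + s^2 b + s^6 + t^2 + a t.
    Whether n is odd or even decides whether F contains a primitive cube root of unity.
    If it does not, a can be scaled to 1, and the images of s^4 + s and t^2 + t have
    index 2, which leaves the three equations of [odd_classes].  If it does, a has
    three classes modulo cubes; for each of the two classes of noncubes b can be
    removed and c has two classes, while for a = 1 there are three equations, in
    all the seven of [even_classes]. *)

Set Implicit Arguments.
Unset Strict Implicit.
Unset Printing Implicit Defensive.
Import GRing.Theory.

(** * Changes of Weierstrass coordinates *)

Section WeierstrassChange.
Local Open Scope ring_scope.

(** The relations between coefficients that result from substituting
    x = u^2 x' + r, y = u^3 y' + s u^2 x' + t in the equation of W and comparing
    it with u^6 times that of W'. *)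
Definition coord_change (K : fieldType) (u r s t : K) (W W' : weierstrass K) : Prop :=
  [/\ u * a1 W' = a1 W + 2 * s,
      u ^+ 2 * a2 W' = a2 W - s * a1 W + 3 * r - s ^+ 2,
      u ^+ 3 * a3 W' = a3 W + r * a1 W + 2 * t,
      u ^+ 4 * a4 W' = a4 W - s * a3 W + 2 * r * a2 W - (t + r * s) * a1 W
                       + 3 * r ^+ 2 - 2 * s * t
    & u ^+ 6 * a6 W' = a6 W + r * a4 W + r ^+ 2 * a2 W + r ^+ 3
                       - t * a3 W - t ^+ 2 - r * t * a1 W].

Definition weq (K : fieldType) (W W' : weierstrass K) : Prop :=
  exists u r s t, u != 0 /\ coord_change u r s t W W'.

Lemma weq_refl (K : fieldType) (W : weierstrass K) : weq W W.
Proof.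
by exists 1, 0, 0, 0; split; [exact: oner_neq0 | split; ring].
Qed.

Lemma solve_unit (K : fieldType) (u x y : K) (k : nat) :
  u != 0 -> u ^+ k * x = y -> x = y / u ^+ k.
Proof. by move=> u0 <-; rewrite mulrC mulKf // expf_neq0. Qed.

Lemma change_inv (K : fieldType) (u r s t : K) (W W' : weierstrass K) :
  u != 0 -> coord_change u r s t W W' ->
  coord_change u^-1 (- r / u ^+ 2) (- s / u) ((r * s - t) / u ^+ 3) W' W.
Proof.
case: W W' => [b1 b2 b3 b4 b6] [d1 d2 d3 d4 d6] u0 [] /=.
rewrite -[in u * _](expr1 u).
move=> /(solve_unit u0)-> /(solve_unit u0)-> /(solve_unit u0)->.
move=> /(solve_unit u0)-> /(solve_unit u0)->.
by split=> /=; field.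
Qed.

Lemma weq_sym (K : fieldType) (W W' : weierstrass K) : weq W W' -> weq W' W.
Proof.
move=> [u [r [s [t [u0 /(change_inv u0) h]]]]].
by do 4 eexists; split; last exact: h; rewrite invr_neq0.
Qed.

Lemma weq_trans (K : fieldType) (W1 W2 W3 : weierstrass K) :
  weq W1 W2 -> weq W2 W3 -> weq W1 W3.
Proof.
move=> [u [r [s [t [u0 h]]]]] [u' [r' [s' [t' [u0' h']]]]].
exists (u * u'), (u ^+ 2 * r' + r), (u * s' + s).
exists (u ^+ 3 * t' + u ^+ 2 * r' * s + t); split; first by rewrite mulf_neq0.
case: W1 W2 W3 h h' => [b1 b2 b3 b4 b6] [d1 d2 d3 d4 d6] [e1 e2 e3 e4 e6] [] /=.
rewrite -[in u * _](expr1 u).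
move=> /(solve_unit u0)-> /(solve_unit u0)-> /(solve_unit u0)->.
move=> /(solve_unit u0)-> /(solve_unit u0)-> [] /=.
rewrite -[in u' * _](expr1 u').
move=> /(solve_unit u0')-> /(solve_unit u0')-> /(solve_unit u0')->.
move=> /(solve_unit u0')-> /(solve_unit u0')->.
by split=> /=; field; rewrite u0 u0'.
Qed.

Lemma change_map (K L : fieldType) (iota : {rmorphism K -> L}) (u r s t : K)
    (W W' : weierstrass K) :
  coord_change u r s t W W' ->
  coord_change (iota u) (iota r) (iota s) (iota t)
    (map_weierstrass iota W) (map_weierstrass iota W').
Proof.
by move=> [h1 h2 h3 h4 h6];
   split=> /=; rewrite -?rmorphXn -rmorphM (h1, h2, h3, h4, h6);
   rewrite !(rmorph_nat, rmorphXn, rmorphN, rmorphB, rmorphM, rmorphD).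
Qed.

Lemma weq_map (K L : fieldType) (iota : {rmorphism K -> L})
    (W W' : weierstrass K) :
  weq W W' -> weq (map_weierstrass iota W) (map_weierstrass iota W').
Proof.
move=> [u [r [s [t [u0 /(change_map iota) h]]]]].
by exists (iota u), (iota r), (iota s), (iota t); rewrite fmorph_eq0.
Qed.

End WeierstrassChange.

(** * Coordinate changes are isomorphisms of projective curves *)

Section ProjectiveCoordinates.
Local Open Scope ring_scope.
Variable L : fieldType.
Implicit Types (P Q : 'rV[L]_3) (W : weierstrass L).

Definition row3 (X Y Z : L) : 'rV[L]_3 := \row_i [:: X; Y; Z]`_i.

Lemma row3E (X Y Z : L) :
  [/\ row3 X Y Z 0 cX = X, row3 X Y Z 0 cY = Y & row3 X Y Z 0 cZ = Z].
Proof. by split; rewrite mxE. Qed.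

Lemma row3_eta P : P = row3 (P 0 cX) (P 0 cY) (P 0 cZ).
Proof.
by apply/rowP=> [[[|[|[|//]]] h]]; rewrite mxE /=;
   [congr (P 0 _)|congr (P 0 _)|congr (P 0 _)]; apply: val_inj.
Qed.

Lemma row3_eq0 (X Y Z : L) : row3 X Y Z = 0 -> [/\ X = 0, Y = 0 & Z = 0].
Proof.
have [hX hY hZ] := row3E X Y Z; move=> h.
by split; [rewrite -hX|rewrite -hY|rewrite -hZ]; rewrite h mxE.
Qed.

Lemma row3_scale (c X Y Z : L) : c *: row3 X Y Z = row3 (c * X) (c * Y) (c * Z).
Proof. by apply/rowP=> [[[|[|[|//]]] h]]; rewrite !mxE. Qed.

Lemma origin_row3 : origin L = row3 0 1 0.
Proof. by apply/rowP=> [[[|[|[|//]]] h]]; rewrite !mxE. Qed.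

Lemma proj_eq_refl P : proj_eq P P.
Proof. by exists 1; rewrite ?oner_neq0 ?scale1r. Qed.

Lemma proj_eq_sym P Q : proj_eq P Q -> proj_eq Q P.
Proof. by move=> [c c0 ->]; exists c^-1; rewrite ?invr_neq0 // scalerK. Qed.

Lemma proj_eq_trans P Q T : proj_eq P Q -> proj_eq Q T -> proj_eq P T.
Proof.
by move=> [c c0 ->] [d d0 ->]; exists (c * d); rewrite ?mulf_neq0 ?scalerA.
Qed.

(** The substitution of [coord_change] in homogeneous coordinates; it goes from
    the curve W' to the curve W. *)
Definition change_point (u r s t : L) P : 'rV[L]_3 :=
  row3 (u ^+ 2 * P 0 cX + r * P 0 cZ)
       (u ^+ 3 * P 0 cY + s * u ^+ 2 * P 0 cX + t * P 0 cZ) (P 0 cZ).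

Lemma change_point_eq0 (u r s t : L) P :
  u != 0 -> change_point u r s t P = 0 -> P = 0.
Proof.
move=> u0; rewrite /change_point => /row3_eq0 [+ + hZ].
rewrite hZ !mulr0 !addr0 => /eqP; rewrite mulf_eq0 expf_eq0 (negPf u0) /= => /eqP hX.
rewrite hX mulr0 addr0 => /eqP; rewrite mulf_eq0 expf_eq0 (negPf u0) /= => /eqP hY.
by rewrite (row3_eta P) hX hY hZ; apply/rowP=> [[[|[|[|//]]] h]]; rewrite !mxE.
Qed.

Lemma change_point_on_curve (u r s t : L) W W' P :
  u != 0 -> coord_change u r s t W W' -> on_curve W' P ->
  on_curve W (change_point u r s t P).
Proof.
move=> u0 h [P0 hP]; split.
  by apply: contra P0 => /eqP /(change_point_eq0 u0)->.
have [-> -> ->] := row3E (u ^+ 2 * P 0 cX + r * P 0 cZ)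
  (u ^+ 3 * P 0 cY + s * u ^+ 2 * P 0 cX + t * P 0 cZ) (P 0 cZ).
move: hP; move: (P 0 cX) (P 0 cY) (P 0 cZ) => X Y Z.
case: W W' h => [b1 b2 b3 b4 b6] [d1 d2 d3 d4 d6] [] /=.
rewrite -[in u * _](expr1 u).
move=> /(solve_unit u0)-> /(solve_unit u0)-> /(solve_unit u0)->.
move=> /(solve_unit u0)-> /(solve_unit u0)-> /eqP; rewrite -subr_eq0 => /eqP h.
apply/eqP; rewrite -subr_eq0; apply/eqP.
by rewrite -[RHS](mulr0 (u ^+ 6)) -h; field.
Qed.

Lemma change_pointK (u r s t : L) P : u != 0 ->
  change_point u^-1 (- r / u ^+ 2) (- s / u) ((r * s - t) / u ^+ 3)
    (change_point u r s t P) = P.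
Proof.
move=> u0; rewrite [RHS]row3_eta /change_point !mxE /=.
by congr row3; field.
Qed.

Lemma change_pointVK (u r s t : L) P : u != 0 ->
  change_point u r s t
    (change_point u^-1 (- r / u ^+ 2) (- s / u) ((r * s - t) / u ^+ 3) P) = P.
Proof.
move=> u0; rewrite [RHS]row3_eta /change_point !mxE /=.
by congr row3; field.
Qed.

End ProjectiveCoordinates.

Section ChangeIsomorphism.
Local Open Scope ring_scope.
Variables (K L : fieldType) (iota : {rmorphism K -> L}).

Definition linform (a b c : K) : {mpoly K[3]} :=
  a *: 'X_cX + b *: 'X_cY + c *: 'X_cZ.

Lemma linform_homog (a b c : K) : linform a b c \is 1.-homog.
Proof.
have hX (i : 'I_3) : ('X_i : {mpoly K[3]}) \is 1.-homog.
  by rewrite dhomogX /= mdeg1.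
by rewrite !dhomogD ?dhomogZ.
Qed.

Lemma linform_eval (a b c : K) (v : 'I_3 -> L) :
  (map_mpoly iota (linform a b c)).@[v]
  = iota a * v cX + iota b * v cY + iota c * v cZ.
Proof.
by rewrite /linform !raddfD /= !map_mpolyZ /= !map_mpolyX !mevalZ !mevalXU.
Qed.

(** The substitution is linear, so one triple of linear forms represents it near
    every point. *)
Lemma change_morphism (u r s t : K) (E E' : elliptic_curve K) :
  u != 0 -> coord_change u r s t E E' ->
  curve_morphism iota E' E (change_point (iota u) (iota r) (iota s) (iota t)).
Proof.
move=> u0 h; have u0' : iota u != 0 by rewrite fmorph_eq0.
split=> P hP; first exact: change_point_on_curve u0' (change_map iota h) hP.
pose phi (i : 'I_3) := [:: linform (u ^+ 2) 0 r; linform (s * u ^+ 2) (u ^+ 3) t;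
  linform 0 0 1]`_i.
have ev Q : eval_triple iota phi Q
            = change_point (iota u) (iota r) (iota s) (iota t) Q.
  apply/rowP=> [[[|[|[|//]]] hi]]; rewrite !mxE /= linform_eval.
  - by rewrite rmorph0 rmorphXn mul0r addr0.
  - by rewrite rmorphM !rmorphXn (addrC (iota s * _ * _)).
  - by rewrite rmorph0 rmorph1 !mul0r !add0r mul1r.
exists 1, phi; split=> [[[|[|[|//]]] hi]||Q _ _].
- exact: linform_homog.
- exact: linform_homog.
- exact: linform_homog.
- by rewrite ev; apply: contra (hP.1) => /eqP /(change_point_eq0 u0')->.
- by rewrite ev; apply: proj_eq_refl.
Qed.

Lemma weq_isomorphic (E E' : elliptic_curve K) :
  weq E E' -> isomorphic iota E E'.
Proof.
move=> [u [r [s [t [u0 h]]]]].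
have u0' : iota u != 0 by rewrite fmorph_eq0.
have h' := change_inv u0 h.
have v0 : u^-1 != 0 by rewrite invr_neq0.
have := change_morphism v0 h'; have := change_morphism u0 h.
have -> : iota u^-1 = (iota u)^-1 by rewrite fmorphV.
have -> : iota (- r / u ^+ 2) = - iota r / iota u ^+ 2.
  by rewrite !(fmorph_div, rmorphN, rmorphXn).
have -> : iota (- s / u) = - iota s / iota u by rewrite !(fmorph_div, rmorphN).
have -> : iota ((r * s - t) / u ^+ 3) = (iota r * iota s - iota t) / iota u ^+ 3.
  by rewrite fmorph_div rmorphXn rmorphB rmorphM.
set f := change_point (iota u) _ _ _; set g := change_point (iota u)^-1 _ _ _.
move=> mf mg; exists g, f; split=> // [P _|P _|].
- by rewrite /f /g change_pointVK //; apply: proj_eq_refl.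
- by rewrite /f /g change_pointK //; apply: proj_eq_refl.
- exists ((iota u)^-1 ^+ 3); first by rewrite expf_neq0 // invr_neq0.
  rewrite origin_row3 row3_scale /g /change_point.
  have [-> -> ->] := row3E (0 : L) 1 0.
  by congr row3; field.
Qed.

End ChangeIsomorphism.

Definition horner_simp :=
  (horner0, hornerC, hornerXn, hornerX, hornerD, hornerN, hornerM, hornerZ, horner_exp).

(** * The norm from the coordinate ring to the polynomials in x *)

Section NormForm.
Local Open Scope ring_scope.
Variables (K : fieldType) (W : weierstrass K).
Implicit Types a b c d : {poly K}.

(** Throughout, the affine equation is read as y^2 = ycub - ylin y, so that the
    coordinate ring is free over K[x] with basis 1, y, and a pair (a, b) of
    polynomials stands for the function a + b y. *)
Definition ylin : {poly K} := a1 W *: 'X + (a3 W)%:P.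
Definition ycub : {poly K} := 'X^3 + (a2 W *: 'X^2 + (a4 W *: 'X + (a6 W)%:P)).

(** The product of a + b y with its conjugate a + b (- y - ylin). *)
Definition ynorm a b : {poly K} := a ^+ 2 - a * b * ylin - b ^+ 2 * ycub.

(** One more than the pole order at the origin of a + b y, and 0 for the zero
    function: x and y have poles of order 2 and 3.  With this shift it behaves
    like the size of a polynomial. *)
Definition pole_size a b : nat :=
  maxn (2 * size a).-1%N (if b == 0 then 0%N else (2 * size b)%N.+2).

Lemma size_ylin : (size ylin <= 2)%N.
Proof.
apply: leq_trans (size_polyD _ _) _; rewrite geq_max.
by rewrite (leq_trans (size_scale_leq _ _)) ?size_polyX // (leq_trans (size_polyC_leq1 _)).
Qed.

Lemma size_ycub : size ycub = 4.
Proof.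
rewrite size_polyDl size_polyXn // ltnS.
apply: leq_trans (size_polyD _ _) _; rewrite geq_max.
rewrite (leq_trans (size_scale_leq _ _)) ?size_polyXn //.
apply: leq_trans (size_polyD _ _) _; rewrite geq_max.
by rewrite (leq_trans (size_scale_leq _ _)) ?size_polyX // (leq_trans (size_polyC_leq1 _)).
Qed.

(** The candidates a^2 and b^2 ycub for the leading term have degrees of
    different parity, hence cannot cancel, and the cross term a b ylin has
    degree below the larger of the two. *)
Lemma size_ynorm a b : size (ynorm a b) = pole_size a b.
Proof.
have sqr_size c : size (c ^+ 2) = (2 * size c).-1.
  have [->|c0] := eqVneq c 0; first by rewrite expr0n size_poly0.
  by rewrite expr2 size_mul // addnn mul2n.
rewrite /ynorm /pole_size; have [->|b0] := eqVneq b 0.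
  by rewrite expr0n /= mul0r mulr0 mul0r !subr0 maxn0 sqr_size.
have g0 : ycub != 0 by rewrite -size_poly_gt0 size_ycub.
have sb : (0 < size b)%N by rewrite size_poly_gt0.
have sg : size (b ^+ 2 * ycub) = (2 * size b).+2.
  by rewrite size_mul ?expf_neq0 // sqr_size size_ycub; move: sb; case: (size b) => // k; lia.
have sm : (size (a * b * ylin)%R <= size a + size b)%N.
  have [->|a0] := eqVneq a 0; first by rewrite !mul0r size_poly0.
  apply: leq_trans (size_polyMleq _ _) _; rewrite size_mul //.
  have sa : (0 < size a)%N by rewrite size_poly_gt0.
  move: (size_ylin) sa sb; move: (size a) (size b) (size ylin) => u v w; lia.
have [h|h] := leqP (2 * size a).-1 (2 * size b).+2.
  rewrite addrC size_polyDl size_polyN sg.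
    by move: h; move: (size a) (size b) => u v; lia.
  apply: leq_ltn_trans (size_polyD _ _) _; rewrite size_polyN sqr_size gtn_max.
  by move: h sm sb; move: (size a) (size b) (size (a * b * ylin)) => u v w; lia.
rewrite size_polyDl size_polyDl ?size_polyN ?sg ?sqr_size;
  move: h sm sb; move: (size a) (size b) (size (a * b * ylin)) => u v w; lia.
Qed.

Lemma pole_sizeD a b c d :
  (pole_size (a + c)%R (b + d)%R <= maxn (pole_size a b) (pole_size c d))%N.
Proof.
rewrite /pole_size; have := size_polyD a c; have := size_polyD b d.
have [->|b0] := eqVneq b 0; have [->|d0] := eqVneq d 0; rewrite ?addr0 ?add0r ?eqxx;
  try (case: eqP => _);
  move: (size (a + c)) (size (b + d)) (size a) (size b) (size c) (size d) =>
    ? ? ? ? ? ?; lia.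
Qed.

Lemma pole_sizeN a b : pole_size (- a) (- b) = pole_size a b.
Proof. by rewrite /pole_size oppr_eq0 !size_polyN. Qed.

(** The pair on the left represents the product of a + b y and c + d y, since
    y^2 = ycub - ylin y. *)
Lemma ynormM a b c d :
  ynorm (a * c + b * d * ycub) (a * d + b * c - b * d * ylin)
  = ynorm a b * ynorm c d.
Proof. by rewrite /ynorm; ring. Qed.

Lemma pole_size_eq0 a b : (pole_size a b == 0%N) = (a == 0) && (b == 0).
Proof.
rewrite /pole_size; have [_|b0] := eqVneq b 0; last by rewrite andbF; lia.
rewrite maxn0 andbT; have [->|a0] := eqVneq a 0; first by rewrite size_poly0.
by move: a0; rewrite -size_poly_gt0; lia.
Qed.

End NormForm.

(** * Regular functions on the affine curve *)

Section CoordinateRing.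
Local Open Scope ring_scope.
Variables (K L : fieldType) (iota : {rmorphism K -> L}) (W : weierstrass K).
Hypothesis closedL : forall p : {poly L}, (1 < size p)%N -> exists x, root p x.
Implicit Types (a b c d : {poly K}) (f h : L -> L -> L).
Local Notation "p ^i" := (map_poly iota p) (at level 2, format "p ^i").

Definition affine (x y : L) : Prop :=
  y ^+ 2 + iota (a1 W) * x * y + iota (a3 W) * y
  = x ^+ 3 + iota (a2 W) * x ^+ 2 + iota (a4 W) * x + iota (a6 W).

Definition represents h a b : Prop :=
  forall x y, affine x y -> h x y = a^i.[x] + b^i.[x] * y.

Definition regular h : Prop := exists a b, represents h a b.
Definition pole_le h (s : nat) : Prop :=
  exists a b, represents h a b /\ (pole_size a b <= s)%N.
Definition pole_eq h (s : nat) : Prop :=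
  exists a b, represents h a b /\ pole_size a b = s.

Lemma ylin_eval x : (ylin W)^i.[x] = iota (a1 W) * x + iota (a3 W).
Proof. by rewrite rmorphD /= map_polyZ map_polyX map_polyC /= !horner_simp. Qed.

Lemma ycub_eval x : (ycub W)^i.[x]
  = x ^+ 3 + iota (a2 W) * x ^+ 2 + iota (a4 W) * x + iota (a6 W).
Proof.
rewrite !rmorphD /= !map_polyZ /= !map_polyXn !map_polyX map_polyC /= !horner_simp.
by ring.
Qed.

Lemma affineE x y :
  affine x y <-> y ^+ 2 = (ycub W)^i.[x] - (ylin W)^i.[x] * y.
Proof.
rewrite ylin_eval ycub_eval /affine; split=> [<-|->]; ring.
Qed.

Lemma affine_conj x y : affine x y -> affine x (- y - (ylin W)^i.[x]).
Proof. by move=> /affineE h; apply/affineE; ring: h. Qed.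

Lemma affine_exists x : exists y, affine x y.
Proof.
pose p : {poly L} := 'X^2 + (((ylin W)^i.[x])%:P * 'X - ((ycub W)^i.[x])%:P).
have sp : size p = 3.
  rewrite size_polyDl size_polyXn // ltnS.
  apply: leq_trans (size_polyD _ _) _; rewrite geq_max size_polyN.
  rewrite mul_polyC (leq_trans (size_scale_leq _ _)) ?size_polyX //.
  by rewrite (leq_trans (size_polyC_leq1 _)).
have [|y /rootP] := closedL (p := p); first by rewrite sp.
rewrite !horner_simp => h; exists y; apply/affineE.
by apply/eqP; rewrite -subr_eq0 -h; apply/eqP; ring.
Qed.

Lemma ynorm_eval a b x y : affine x y ->
  (ynorm W a b)^i.[x]
  = (a^i.[x] + b^i.[x] * y) * (a^i.[x] + b^i.[x] * (- y - (ylin W)^i.[x])).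
Proof.
move=> /affineE h; rewrite /ynorm !(rmorphB, rmorphM, rmorphXn) /= !horner_simp.
by ring: h.
Qed.

(** The norm of such a function vanishes at every x of L, because a point lies
    over each x; over an algebraically closed L the norm is then 0, and its
    size determines the pole size. *)
Lemma represents0 a b : represents (fun _ _ => 0) a b -> a = 0 /\ b = 0.
Proof.
move=> h; suff : ynorm W a b == 0.
  by rewrite -size_poly_eq0 size_ynorm pole_size_eq0 => /andP[/eqP-> /eqP->].
set N := ynorm W a b.
have N0 x : N^i.[x] = 0.
  have [y hy] := affine_exists x.
  by rewrite (ynorm_eval _ _ hy) -h // mul0r.
(* N + 1 has no root, hence is constant. *)
have [hs|hs] := leqP (size (N^i + 1)) 1.
  have [c hc] : exists c : L, N^i = c%:P.
    exists ((N^i + 1)`_0 - 1); rewrite polyCB -size1_polyC //.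
    by rewrite addrK.
  by have := N0 0; rewrite -(map_poly_eq0 iota) hc hornerC => ->.
have [x /rootP] := closedL hs.
by rewrite !horner_simp N0 add0r => /eqP; rewrite oner_eq0.
Qed.

Lemma represents_uniq h a b c d :
  represents h a b -> represents h c d -> a = c /\ b = d.
Proof.
move=> h1 h2; have [] := @represents0 (a - c) (b - d); last first.
  by move=> /eqP + /eqP; rewrite !subr_eq0 => /eqP-> /eqP->.
move=> x y hy; rewrite !rmorphB /= !horner_simp.
have := h1 _ _ hy; rewrite (h2 _ _ hy) => e.
transitivity (a^i.[x] + b^i.[x] * y - (c^i.[x] + d^i.[x] * y)); last by ring.
by rewrite e subrr.
Qed.

Lemma representsD h a b f c d : represents h a b -> represents f c d ->
  represents (fun x y => h x y + f x y) (a + c) (b + d).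
Proof.
move=> h1 h2 x y hy; rewrite (h1 _ _ hy) (h2 _ _ hy) !rmorphD /= !horner_simp.
ring.
Qed.

Lemma representsM h a b f c d : represents h a b -> represents f c d ->
  represents (fun x y => h x y * f x y) (a * c + b * d * ycub W)
    (a * d + b * c - b * d * ylin W).
Proof.
move=> h1 h2 x y hy; rewrite (h1 _ _ hy) (h2 _ _ hy).
move/affineE: hy; move: (ycub W) (ylin W) => g l e.
by rewrite !(rmorphB, rmorphM, rmorphD) /= !horner_simp; ring: e.
Qed.

Lemma represents_const (c : K) : represents (fun _ _ => iota c) c%:P 0.
Proof. by move=> x y _; rewrite map_polyC rmorph0 !horner_simp; ring. Qed.

Lemma represents_x : represents (fun x _ => x) 'X 0.
Proof. by move=> x y _; rewrite map_polyX rmorph0 !horner_simp; ring. Qed.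

Lemma represents_y : represents (fun _ y => y) 0 1.
Proof. by move=> x y _; rewrite rmorph0 rmorph1 -polyC1 !horner_simp; ring. Qed.

Lemma regularD h f : regular h -> regular f -> regular (fun x y => h x y + f x y).
Proof. by move=> [a [b h1]] [c [d h2]]; do 2 eexists; apply: representsD h1 h2. Qed.

Lemma regularM h f : regular h -> regular f -> regular (fun x y => h x y * f x y).
Proof. by move=> [a [b h1]] [c [d h2]]; do 2 eexists; apply: representsM h1 h2. Qed.

(** The denominators of h that lie in K[x] form an ideal.  Over each x there are
    two conjugate points, and some denominator B vanishes at neither; its norm is
    a denominator in K[x] that is nonzero at x.  A generator of the ideal thus
    has no root in L, so it is constant. *)
Lemma regular_local h :
  (forall x y, affine x y -> exists A B, [/\ regular A, regular B, B x y != 0 &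
     forall x' y', affine x' y' -> B x' y' != 0 -> h x' y' * B x' y' = A x' y']) ->
  regular h.
Proof.
move=> hloc.
pose denom p := exists2 A, regular A &
  forall x y, affine x y -> h x y * p^i.[x] = A x y.
pose denomB a b := exists2 A, regular A &
  forall x y, affine x y -> h x y * (a^i.[x] + b^i.[x] * y) = A x y.
have denomB_norm a b : denomB a b -> denom (ynorm W a b).
  move=> [A [c [d hA]] e]; pose f x y := a^i.[x] + b^i.[x] * (- y - (ylin W)^i.[x]).
  exists (fun x y => A x y * f x y); last first.
    by move=> x y hy; rewrite (ynorm_eval _ _ hy) mulrA e.
  apply: regularM; first by exists c, d.
  exists (a - b * ylin W), (- b) => x y _.
  by rewrite rmorphB rmorphN rmorphM /= !horner_simp /f; ring.
have denom_at x y : affine x y ->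
    exists a b, denomB a b /\ a^i.[x] + b^i.[x] * y != 0.
  move=> hy; have [A [B [hA hB B0 hAB]]] := hloc _ _ hy.
  (* h B = A is known only where B is nonzero; h B^2 = A B holds everywhere. *)
  have [a [b hB2]] := regularM hB hB.
  exists a, b; rewrite -hB2 // mulf_neq0 //; split=> //.
  exists (fun x y => A x y * B x y); first exact: regularM.
  move=> x' y' hy'; rewrite -hB2 //.
  have [->|B'0] := eqVneq (B x' y') 0; first by rewrite !mulr0.
  by rewrite mulrA hAB.
have denom_over x : exists2 p, denom p & p^i.[x] != 0.
  have [y hy] := affine_exists x; have hy' := affine_conj hy.
  have [a [b [d1 ne1]]] := denom_at _ _ hy.
  have [c [d [d2 ne2]]] := denom_at _ _ hy'.
  have done a' b' : denomB a' b' -> a'^i.[x] + b'^i.[x] * y != 0 ->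
      a'^i.[x] + b'^i.[x] * (- y - (ylin W)^i.[x]) != 0 ->
      exists2 p, denom p & p^i.[x] != 0.
    move=> /denomB_norm hd n1 n2; exists (ynorm W a' b') => //.
    by rewrite (ynorm_eval _ _ hy) mulf_neq0.
  have [z1|n1] := eqVneq (a^i.[x] + b^i.[x] * (- y - (ylin W)^i.[x])) 0;
    last exact: (done a b).
  have [z2|n2] := eqVneq (c^i.[x] + d^i.[x] * y) 0; last exact: (done c d).
  (* Each of the two denominators vanishes at the other point: add them. *)
  apply: (done (a + c) (b + d)).
  - case: d1 d2 => [A hA e1] [C hC e2].
    exists (fun x y => A x y + C x y); first exact: regularD.
    by move=> x' y' h'; rewrite -e1 // -e2 // !rmorphD /= !horner_simp; ring.
  - rewrite (rmorphD _ a) (rmorphD _ b) /= (hornerD a^i) (hornerD b^i).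
    suff -> : a^i.[x] + c^i.[x] + (b^i.[x] + d^i.[x]) * y = a^i.[x] + b^i.[x] * y by [].
    by rewrite -[RHS]addr0 -z2; ring.
  - rewrite (rmorphD _ a) (rmorphD _ b) /= (hornerD a^i) (hornerD b^i).
    suff -> : a^i.[x] + c^i.[x] + (b^i.[x] + d^i.[x]) * (- y - (ylin W)^i.[x])
      = c^i.[x] + d^i.[x] * (- y - (ylin W)^i.[x]) by [].
    by rewrite -[RHS]addr0 -z1; ring.
(* A nonzero denominator of minimal size generates the ideal. *)
have : exists s, boolp.asbool (exists p, [/\ denom p, p != 0 & size p = s]).
  have [p dp px] := denom_over 0; exists (size p); apply/boolp.asboolP.
  exists p; split=> //; apply: contraNneq px => ->; by rewrite rmorph0 horner0.
case/ex_minnP => s /boolp.asboolP [p [dp p0 ps]] smin.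
have p_dvd q : denom q -> p %| q.
  move=> dq; apply/modp_eq0P; apply/eqP; apply: contraT => r0.
  suff : (s <= size (q %% p)%R)%N by rewrite -ps leqNgt ltn_modp p0.
  apply: smin; apply/boolp.asboolP; exists (q %% p); split=> //.
  case: dp dq => [A hA e1] [C [c1 [c2 hC]] e2].
  exists (fun x y => C x y + (- (q %/ p))^i.[x] * A x y).
    apply: regularD; first by exists c1, c2.
    apply: regularM => //; exists (- (q %/ p)), 0 => x y _.
    by rewrite rmorph0 !horner_simp mul0r addr0.
  move=> x y hy; rewrite -e1 // -e2 // [in q^i](divp_eq q p).
  by rewrite !(rmorphD, rmorphM, rmorphN) /= !horner_simp; ring.
have [sp1|sp1] := leqP (size p) 1; last first.
  have [x /rootP x0] : exists x, root p^i x by apply: closedL; rewrite size_map_poly.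
  have [q /p_dvd /dvdpP [c ->]] := denom_over x.
  by rewrite rmorphM /= hornerM x0 mulr0 eqxx.
case: dp => [A [a [b hA]] e].
move: p0 e; rewrite (size1_polyC sp1) polyC_eq0; set c := p`_0 => c0 e.
exists (c^-1 *: a), (c^-1 *: b) => x y hy.
rewrite !map_polyZ /= !horner_simp -mulrA -mulrDr -hA // -e // map_polyC hornerC /=.
by rewrite mulrCA -rmorphM mulVf // rmorph1 mulr1.
Qed.

End CoordinateRing.

(** * Pole orders at the origin *)

Section PoleOrders.
Local Open Scope ring_scope.
Variables (K L : fieldType) (iota : {rmorphism K -> L}) (W : weierstrass K).
Hypothesis closedL : forall p : {poly L}, (1 < size p)%N -> exists x, root p x.
Implicit Types (a b c d : {poly K}) (f h : L -> L -> L).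
Local Notation "p ^i" := (map_poly iota p) (at level 2, format "p ^i").
Local Notation aff := (affine iota W).
Local Notation regular := (regular iota W).
Local Notation represents := (represents iota W).
Local Notation pole_le := (pole_le iota W).
Local Notation pole_eq := (pole_eq iota W).

Lemma eq_represents h f a b : (forall x y, aff x y -> h x y = f x y) ->
  represents h a b -> represents f a b.
Proof. by move=> e hr x y hy; rewrite -e // hr. Qed.

Lemma pole_eq_ext h f s : (forall x y, aff x y -> h x y = f x y) ->
  pole_eq h s -> pole_eq f s.
Proof.
by move=> e [a [b [hr hs]]]; exists a, b; split=> //; apply: eq_represents hr.
Qed.

Lemma regular_pole_eq h : regular h -> exists s, pole_eq h s.
Proof. by move=> [a [b hr]]; exists (pole_size a b), a, b. Qed.

Lemma pole_eqW h s s' : pole_eq h s -> (s <= s')%N -> pole_le h s'.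
Proof. by move=> [a [b [hr <-]]]; exists a, b. Qed.

Lemma pole_leW h s s' : pole_le h s -> (s <= s')%N -> pole_le h s'.
Proof. by move=> [a [b [hr hs]]] h1; exists a, b; split=> //; apply: leq_trans h1. Qed.

Lemma pole_eq_le h s s' : pole_eq h s -> pole_le h s' -> (s <= s')%N.
Proof.
by move=> [a [b [hr <-]]] [c [d [/(represents_uniq closedL hr)[<- <-]]]].
Qed.

Lemma pole_eq_uniq h s s' : pole_eq h s -> pole_eq h s' -> s = s'.
Proof.
by move=> h1 h2; apply/eqP; rewrite eqn_leq !(pole_eq_le h1, pole_eq_le h2) //;
  [exact: pole_eqW h1 _|exact: pole_eqW h2 _].
Qed.

Lemma pole_leD h f s : pole_le h s -> pole_le f s ->
  pole_le (fun x y => h x y + f x y) s.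
Proof.
move=> [a [b [hr hs]]] [c [d [fr fs]]]; exists (a + c), (b + d).
split; first exact: representsD hr fr.
by rewrite (leq_trans (pole_sizeD _ _ _ _)) // geq_max hs fs.
Qed.

Lemma pole_eqD h f s s' : pole_eq h s -> pole_le f s' -> (s' < s)%N ->
  pole_eq (fun x y => h x y + f x y) s.
Proof.
move=> [a [b [hr hs]]] [c [d [fr fs]]] lt; exists (a + c), (b + d).
split; first exact: representsD hr fr.
have := pole_sizeD a b c d; have := pole_sizeD (a + c) (b + d) (- c) (- d).
rewrite pole_sizeN !addrK; move: hs fs lt.
by move: (pole_size _ _) (pole_size _ _) (pole_size _ _) => u v w; lia.
Qed.

(** Multiplicativity of pole orders is multiplicativity of the norm. *)
Lemma pole_eqM h f s s' : pole_eq h s.+1 -> pole_eq f s'.+1 ->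
  pole_eq (fun x y => h x y * f x y) (s + s').+1.
Proof.
move=> [a [b [hr hs]]] [c [d [fr fs]]]; do 2 eexists.
split; first exact: representsM hr fr.
move: hs fs; rewrite -!(size_ynorm W) ynormM => hs fs.
rewrite size_mul ?hs ?fs ?addnS //=; by rewrite -size_poly_gt0 ?hs ?fs.
Qed.

Lemma pole_leM h f s s' : pole_le h s.+1 -> pole_le f s'.+1 ->
  pole_le (fun x y => h x y * f x y) (s + s').+1.
Proof.
move=> [a [b [hr hs]]] [c [d [fr fs]]]; do 2 eexists.
split; first exact: representsM hr fr.
move: hs fs; rewrite -!(size_ynorm W) ynormM => hs fs.
by rewrite (leq_trans (size_polyMleq _ _)) //; lia.
Qed.

Lemma pole_eq_const (c : K) : c != 0 -> pole_eq (fun _ _ => iota c) 1.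
Proof.
move=> c0; exists c%:P, 0; split; first exact: represents_const.
by rewrite /pole_size eqxx size_polyC c0.
Qed.

Lemma pole_le_const (c : K) : pole_le (fun _ _ => iota c) 1.
Proof.
exists c%:P, 0; split; first exact: represents_const.
by rewrite /pole_size eqxx size_polyC; case: (c == 0).
Qed.

Lemma pole_eq_x : pole_eq (fun x _ => x) 3.
Proof.
exists 'X, 0; split; first exact: represents_x.
by rewrite /pole_size eqxx size_polyX.
Qed.

Lemma pole_eq_y : pole_eq (fun _ y => y) 4.
Proof.
exists 0, 1; split; first exact: represents_y.
by rewrite /pole_size oner_eq0 size_poly0 size_polyC oner_eq0.
Qed.

Lemma pole_le1_const h : pole_le h 1 ->
  exists c : K, forall x y, aff x y -> h x y = iota c.
Proof.
move=> [a [b [hr]]]; rewrite /pole_size; case: (eqVneq b 0) => [b0|b0]; last by lia.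
rewrite maxn0 => ha; exists a`_0 => x y hy; rewrite hr // b0 rmorph0 horner0 mul0r addr0.
have sa : (size a <= 1)%N by move: ha; move: (size a) => u; lia.
by rewrite [in LHS](size1_polyC sa) map_polyC hornerC.
Qed.

Lemma size2_poly_eval a x : (size a <= 2)%N -> a^i.[x] = iota a`_0 + iota a`_1 * x.
Proof.
move=> sa; rewrite (@horner_coef_wide _ 2) ?size_map_poly //.
by rewrite !big_ord_recl big_ord0 !coef_map /= expr0 mulr1 addr0 expr1.
Qed.

Lemma pole_eq3_linear h : pole_eq h 3 ->
  exists r v : K, v != 0 /\ forall x y, aff x y -> h x y = iota r + iota v * x.
Proof.
move=> [a [b [hr]]]; rewrite /pole_size.
case: (eqVneq b 0) => [b0|b0] ha; last first.
  have : (0 < size b)%N by rewrite size_poly_gt0.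
  by move: ha; move: (size a) (size b) => u v; lia.
have sa : size a = 2 by move: ha; move: (size a) => u; lia.
exists a`_0, a`_1; split; last first.
  by move=> x y hy; rewrite hr // b0 rmorph0 horner0 mul0r addr0 size2_poly_eval ?sa.
have : lead_coef a != 0 by rewrite lead_coef_eq0 -size_poly_gt0 sa.
by rewrite lead_coefE sa.
Qed.

Lemma pole_eq4_linear h : pole_eq h 4 ->
  exists t s v : K, v != 0 /\
    forall x y, aff x y -> h x y = iota t + iota s * x + iota v * y.
Proof.
move=> [a [b [hr]]]; rewrite /pole_size.
case: (eqVneq b 0) => [b0|b0] ha.
  by move: ha; move: (size a) => u; lia.
have sb : size b = 1%N.
  have : (0 < size b)%N by rewrite size_poly_gt0.
  by move: ha; move: (size a) (size b) => u v; lia.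
have sa : (size a <= 2)%N by move: ha; move: (size a) (size b) => u v; lia.
exists a`_0, a`_1, b`_0; split; last first.
  move=> x y hy; rewrite hr // size2_poly_eval //.
  have sb1 : (size b <= 1)%N by rewrite sb.
  by rewrite [b in LHS](size1_polyC sb1) map_polyC hornerC.
have : lead_coef b != 0 by rewrite lead_coef_eq0.
by rewrite lead_coefE sb.
Qed.

Lemma pole_eq_comp h p A : pole_eq h A.+1 -> (0 < A)%N -> p != 0 ->
  pole_eq (fun x y => p^i.[h x y]) ((size p).-1 * A).+1.
Proof.
move=> hA A0; elim/poly_ind: p => [|p c IH]; first by rewrite eqxx.
have [->|p0] := eqVneq p 0.
  rewrite mul0r add0r polyC_eq0 => c0; rewrite size_polyC c0 /= mul0n.
  apply: pole_eq_ext (pole_eq_const c0) => x y _.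
  by rewrite map_polyC hornerC.
move=> _; have s0 : (0 < size p)%N by rewrite size_poly_gt0.
have -> : ((size (p * 'X + c%:P)%R).-1 * A = (size p).-1 * A + A)%N.
  rewrite size_MXaddC (negPf p0) /=; move: s0; case: (size p) => // k _.
  by rewrite mulSn addnC.
have h1 := pole_eqM (IH p0) hA.
apply: pole_eq_ext (pole_eqD h1 (pole_le_const c) _); last by lia.
move=> x y _; rewrite rmorphD rmorphM /= map_polyX map_polyC /=.
by rewrite !horner_simp.
Qed.

Section GeneratingPair.
Variables (W' : weierstrass K) (al be : L -> L -> L).
Hypothesis (al_reg : regular al) (be_reg : regular be).
Hypothesis on_W' : forall x y, aff x y ->
  affine iota W' (al x y) (be x y).
Variables p q p' q' : {poly K}.
Hypothesis x_gen : forall x y, aff x y -> x = p^i.[al x y] + q^i.[al x y] * be x y.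
Hypothesis y_gen : forall x y, aff x y -> y = p'^i.[al x y] + q'^i.[al x y] * be x y.

(** If al is constant, comparing poles in the equation of W' forces be to be
    constant, and then x would be constant as well. *)
Lemma pole_al_gt1 : ~ pole_le al 1.
Proof.
move=> /pole_le1_const [c hc].
have [[|[|s]] hs] := regular_pole_eq be_reg; last first.
  pose lhs x y := be x y * be x y + iota (a1 W' * c + a3 W') * be x y.
  have h1 : pole_eq lhs (s.+1 + s.+1).+1.
    apply: pole_eqD (pole_eqM hs hs) _ (_ : s.+2 < _)%N; last by lia.
    exact: (pole_leM (s := 0) (pole_le_const _) (pole_eqW hs (leqnn _))).
  have e x y : aff x y ->
      lhs x y = iota (c ^+ 3 + a2 W' * c ^+ 2 + a4 W' * c + a6 W').
    move=> hy; have := on_W' hy; rewrite /affine hc // /lhs.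
    by rewrite !(rmorphD, rmorphM, rmorphXn) /= => <-; ring.
  have := pole_eq_le (pole_eq_ext e h1) (pole_le_const _); lia.
all: have [d hd] := pole_le1_const (pole_eqW (s' := 1) hs isT).
all: have e x y : aff x y -> x = iota (p.[c] + q.[c] * d)
  by move=> hy; rewrite [LHS](x_gen hy) hc // hd // !horner_map /= rmorphD rmorphM.
all: have := pole_eq_le (pole_eq_ext e pole_eq_x) (pole_le_const _); lia.
Qed.

(** In the equation of W' the terms be^2 and al^3 dominate all others, so twice
    the pole order of be is three times that of al. *)
Lemma pole_al_be : exists2 m, (0 < m)%N &
  pole_eq al (2 * m).+1 /\ pole_eq be (3 * m).+1.
Proof.
have [sa hal] := regular_pole_eq al_reg; have [sb hbe] := regular_pole_eq be_reg.
have sa1 : (1 < sa)%N.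
  by rewrite ltnNge; apply/negP => h; apply: pole_al_gt1; apply: pole_eqW hal h.
move: sa sa1 hal => [//|A] A0 hal.
have lal := pole_eqW hal (leqnn _).
pose lhs x y := be x y * be x y + (iota (a1 W') * al x y + iota (a3 W')) * be x y.
pose rhs x y := al x y * al x y * al x y + ((iota (a2 W') * (al x y * al x y)
   + iota (a4 W') * al x y) + iota (a6 W')).
have e x y : aff x y -> lhs x y = rhs x y.
  move=> hy; have := on_W' hy; rewrite /affine /lhs /rhs => e.
  transitivity (be x y ^+ 2 + iota (a1 W') * al x y * be x y + iota (a3 W') * be x y);
    by [ring | rewrite e; ring].
have lin_le : pole_le (fun x y => iota (a1 W') * al x y + iota (a3 W')) A.+1.
  apply: pole_leD; first exact: (pole_leM (s := 0) (pole_le_const _) lal).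
  exact: pole_leW (pole_le_const _) _.
have aa_le := pole_leM lal lal.
have quad_le : pole_le (fun x y => (iota (a2 W') * (al x y * al x y)
   + iota (a4 W') * al x y) + iota (a6 W')) (A + A).+1.
  apply: pole_leD; last exact: pole_leW (pole_le_const _) _.
  apply: pole_leD; first exact: (pole_leM (s := 0) (pole_le_const _) aa_le).
  apply: pole_leW (pole_leM (s := 0) (pole_le_const _) lal) _; lia.
have rhs_eq : pole_eq rhs (A + A + A).+1.
  by apply: pole_eqD (pole_eqM (pole_eqM hal hal) hal) quad_le _; lia.
pose B := sb.-1.
have lbe : pole_le be B.+1 by apply: pole_eqW hbe _; rewrite /B; lia.
(* For be = 0 the truncated B is 0, and the bound below excludes this case. *)
have h1 : (3 * A <= 2 * B)%N.
  rewrite leqNgt; apply/negP => lt.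
  have : pole_le lhs (A + A + A).
    apply: pole_leD.
      by apply: pole_leW (pole_leM lbe lbe) _; lia.
    by apply: pole_leW (pole_leM lin_le lbe) _; lia.
  by move=> /(pole_eq_le (pole_eq_ext (fun x y (hy : aff x y) => esym (e x y hy)) rhs_eq)); lia.
have hbe' : pole_eq be B.+1 by rewrite /B prednK //; lia.
have h2 : (2 * B <= 3 * A)%N.
  rewrite leqNgt; apply/negP => lt.
  have : pole_eq lhs (B + B).+1.
    by apply: pole_eqD (pole_eqM hbe' hbe') (pole_leM lin_le lbe) _; lia.
  by move=> /(pole_eq_ext e) /(pole_eq_uniq rhs_eq); lia.
exists (A %/ 2)%N; first by lia.
by split; [move: hal | move: hbe']; congr (pole_eq _ _); lia.
Qed.

(** In P(al) + Q(al) be the two summands have pole orders that are an even and an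
    odd multiple of m, so that no cancellation occurs. *)
Lemma pole_comp_dvd m P Q h s : (0 < m)%N ->
  pole_eq al (2 * m).+1 -> pole_eq be (3 * m).+1 ->
  (forall x y, aff x y -> h x y = P^i.[al x y] + Q^i.[al x y] * be x y) ->
  pole_eq h s.+1 -> (m %| s)%N.
Proof.
move=> m0 hal hbe e hs.
have A0 : (0 < 2 * m)%N by lia.
have QE : Q != 0 -> pole_eq (fun x y => Q^i.[al x y] * be x y)
    ((size Q).-1 * (2 * m) + 3 * m).+1.
  by move=> Q0; apply: pole_eqM hbe; apply: pole_eq_comp.
have [P0|P0] := eqVneq P 0; have [Q0|Q0] := eqVneq Q 0.
- suff h0 : pole_eq h 0%N by have := pole_eq_uniq hs h0.
  exists 0, 0; split; last by apply/eqP; rewrite pole_size_eq0 !eqxx.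
  by move=> x y hy; rewrite e // P0 Q0 !rmorph0 !horner0 !mul0r.
- have h1 : pole_eq h ((size Q).-1 * (2 * m) + 3 * m).+1.
    apply: pole_eq_ext (QE Q0) => x y hy.
    by rewrite e // P0 rmorph0 horner0 add0r.
  have [->] := pole_eq_uniq hs h1.
  by rewrite mulnA -mulnDl dvdn_mull.
- have h1 : pole_eq h ((size P).-1 * (2 * m)).+1.
    apply: pole_eq_ext (pole_eq_comp hal A0 P0) => x y hy.
    by rewrite e // Q0 rmorph0 horner0 mul0r addr0.
  have [->] := pole_eq_uniq hs h1.
  by rewrite mulnA dvdn_mull.
- have hP := pole_eq_comp hal A0 P0; have hQ := QE Q0.
  move: (size P).-1 (size Q).-1 hP hQ => k l hP hQ.
  have ne : (k * (2 * m) != l * (2 * m) + 3 * m)%N.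
    by rewrite !mulnA -mulnDl eqn_pmul2r //; lia.
  case: (ltngtP (k * (2 * m)) (l * (2 * m) + 3 * m)) ne => // lt _.
    have h1 : pole_eq h (l * (2 * m) + 3 * m).+1.
      apply: pole_eq_ext (pole_eqD hQ (pole_eqW hP (leqnn _)) _) => // x y hy.
      by rewrite e // addrC.
    have [->] := pole_eq_uniq hs h1.
    by rewrite mulnA -mulnDl dvdn_mull.
  have h1 : pole_eq h (k * (2 * m)).+1.
    apply: pole_eq_ext (pole_eqD hP (pole_eqW hQ (leqnn _)) _) => // x y hy.
    by rewrite e.
  have [->] := pole_eq_uniq hs h1.
  by rewrite mulnA dvdn_mull.
Qed.

(** Both x (pole order 2) and y (pole order 3) are polynomials in al and be, so
    m divides 2 and 3. *)
Lemma pole_al3_be4 : pole_eq al 3 /\ pole_eq be 4.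
Proof.
have [m m0 [hal hbe]] := pole_al_be.
have hx := pole_comp_dvd m0 hal hbe x_gen pole_eq_x.
have hy := pole_comp_dvd m0 hal hbe y_gen pole_eq_y.
have m1 : m = 1%N.
  have : (m %| 3 - 2)%N by rewrite dvdn_sub.
  by rewrite dvdn1 => /eqP.
by move: hal hbe; rewrite m1.
Qed.

(** By their pole orders, al = r + v x and be = t + s x + w y; the equation of W'
    for (al, be) must be a multiple of that of W.  Its x^3 coefficient gives
    v^3 = w^2, whence v = u^2 and w = u^3 with u = w / v. *)
Lemma affine_iso_change : exists u r s t, u != 0 /\ coord_change u r s t W' W.
Proof.
have [/pole_eq3_linear [r [v [v0 hal]]] /pole_eq4_linear [t [s [w [w0 hbe]]]]]
  := pole_al3_be4.
(* A + B y is the equation of W' at (al, be), reduced to normal form. *)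
pose A : {poly K} := (r ^+ 3 + a2 W' * r ^+ 2 + a4 W' * r + a6 W' - t ^+ 2
    - w ^+ 2 * a6 W - a1 W' * r * t - a3 W' * t)%:P
  + (3 * r ^+ 2 * v + a2 W' * 2 * r * v + a4 W' * v - 2 * t * s - w ^+ 2 * a4 W
     - a1 W' * (r * s + v * t) - a3 W' * s) *: 'X
  + (3 * r * v ^+ 2 + a2 W' * v ^+ 2 - s ^+ 2 - w ^+ 2 * a2 W - a1 W' * v * s) *: 'X^2
  + (v ^+ 3 - w ^+ 2) *: 'X^3.
pose B : {poly K} := (- (2 * w * t) + w ^+ 2 * a3 W - a1 W' * w * r - a3 W' * w)%:P
  + (- (2 * w * s) + w ^+ 2 * a1 W - a1 W' * w * v) *: 'X.
have [] := @represents0 _ _ iota W closedL A B.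
  move=> x y hy; have := on_W' hy; rewrite /affine hal // hbe // => e.
  rewrite !rmorphD /= !map_polyZ /= !map_polyXn !map_polyX !map_polyC /= !horner_simp.
  have {e} : 0 = (iota r + iota v * x) ^+ 3
     + iota (a2 W') * (iota r + iota v * x) ^+ 2
     + iota (a4 W') * (iota r + iota v * x) + iota (a6 W')
     - ((iota t + iota s * x + iota w * y) ^+ 2
        + iota (a1 W') * (iota r + iota v * x) * (iota t + iota s * x + iota w * y)
        + iota (a3 W') * (iota t + iota s * x + iota w * y)) by rewrite e subrr.
  move=> ->.
  have e : y ^+ 2 = x ^+ 3 + iota (a2 W) * x ^+ 2 + iota (a4 W) * x + iota (a6 W)
    - iota (a1 W) * x * y - iota (a3 W) * y.
    by move: hy; rewrite /affine => <-; ring.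
  by ring: e.
move=> /polyP hA /polyP hB.
move: (hA 0) (hA 1) (hA 2) (hA 3) (hB 0) (hB 1).
rewrite !coefE /= !(mulr0, mulr1, addr0, add0r).
move=> e0 e1 e2 e3 f0 f1.
have ev : v = (w / v) ^+ 2.
  move/eqP: e3; rewrite subr_eq0 => /eqP e3.
  by rewrite expr_div_n -e3 exprS mulfK // expf_neq0.
have ew : w = (w / v) ^+ 3.
  by rewrite exprS -ev mulfVK.
move: (w / v) ev ew => u ev ew; subst v w.
have u0 : u != 0 by move: v0; rewrite expf_eq0.
exists u, r, (s / u ^+ 2), t; split=> //.
have scaled k (X Y Z : K) : Z = 0 -> u ^+ k * (X - Y) = Z -> X = Y.
  move=> -> /eqP; rewrite mulf_eq0 expf_eq0 (negPf u0) andbF /= subr_eq0.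
  by move/eqP.
split=> /=.
- by apply: (scaled 5 _ _ _ f1); field.
- by apply/esym/(scaled 4 _ _ _ e2); field.
- by apply: (scaled 3 _ _ _ f0); field.
- by apply/esym/(scaled 2 _ _ _ e1); field.
- by apply/esym/(scaled 0 _ _ _ e0); field.
Qed.
End GeneratingPair.

End PoleOrders.

(** * Isomorphisms are coordinate changes *)

Section MorphismCharts.
Local Open Scope ring_scope.
Variables (K L : fieldType) (iota : {rmorphism K -> L}).
Hypothesis closedL : forall p : {poly L}, (1 < size p)%N -> exists x, root p x.
Implicit Types (E : elliptic_curve K) (P Q : 'rV[L]_3) (f g : 'rV[L]_3 -> 'rV[L]_3).
Local Notation "p ^i" := (map_poly iota p) (at level 2, format "p ^i").

Lemma on_curve_affine E x y :
  on_curve (base_change iota E) (row3 x y 1) <-> affine iota E x y.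
Proof.
have [hX hY hZ] := row3E x y 1.
rewrite /on_curve hX hY hZ /affine /=; split=> [[_ e]|e].
  move: e; rewrite !expr1n !mulr1 => e; exact: e.
split; last by rewrite !expr1n !mulr1.
by apply/eqP => /row3_eq0 [_ _ /eqP]; rewrite oner_eq0.
Qed.

Lemma on_curve_origin E : on_curve (base_change iota E) (origin L).
Proof.
have [hX hY hZ] := row3E (0 : L) 1 0.
rewrite /on_curve origin_row3 hX hY hZ; split; last by ring.
by apply/eqP => /row3_eq0 [_ /eqP + _]; rewrite oner_eq0.
Qed.

Lemma coordZ c P i : (c *: P) 0 i = c * P 0 i.
Proof. by rewrite mxE. Qed.

Lemma on_curve_scale (W : weierstrass L) c P :
  c != 0 -> on_curve W P -> on_curve W (c *: P).
Proof.
move=> c0 [P0 e]; split; first by rewrite scaler_eq0 negb_or c0.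
rewrite !mxE; move: e; move: (P 0 cX) (P 0 cY) (P 0 cZ) => X Y Z e.
transitivity (c ^+ 3 * (Y ^+ 2 * Z + a1 W * X * Y * Z + a3 W * Y * Z ^+ 2));
  first by ring.
by rewrite e; ring.
Qed.

(** On the line Z = 0 the equation reduces to X^3 = 0. *)
Lemma on_curve_infinity (W : weierstrass L) P :
  on_curve W P -> P 0 cZ = 0 -> proj_eq P (origin L).
Proof.
move=> [P0 e] z0; move: e; rewrite z0 => e.
have x0 : P 0 cX = 0.
  have e3 : P 0 cX ^+ 3 = 0 by move: e; rewrite !expr0n /= !mulr0 !addr0 => <-.
  by apply/eqP; move/eqP: e3; rewrite expf_eq0.
have PE : P = P 0 cY *: origin L.
  by rewrite {1}(row3_eta P) x0 z0 origin_row3 row3_scale mulr0 mulr1.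
exists (P 0 cY) => //; apply: contraNneq P0 => y0; by rewrite PE y0 scale0r.
Qed.

Lemma eval_tripleZ (phi : 'I_3 -> {mpoly K[3]}) d c P :
  (forall i, phi i \is d.-homog) ->
  eval_triple iota phi (c *: P) = c ^+ d *: eval_triple iota phi P.
Proof.
move=> hphi; apply/rowP=> i; rewrite !mxE.
have := hphi i; move: (phi i) => p hp.
rewrite !mevalE mulr_sumr; apply: eq_big_seq => m hm.
have md : mdeg m = d.
  move/dhomogP: hp => -> //; move: hm; apply: contraLR.
  by rewrite !mcoeff_msupp !negbK mcoeff_map_mpoly => /eqP ->; rewrite raddf0.
under eq_bigr => j _ do rewrite mxE exprMn.
rewrite big_split /= prodrXr -mdegE md.
by rewrite mulrCA.
Qed.

(** The local representatives are homogeneous, so a morphism is compatible with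
    proportionality of coordinates. *)
Lemma morphism_proj_eq E E' f P Q : curve_morphism iota E E' f ->
  on_curve (base_change iota E) P -> proj_eq P Q ->
  proj_eq (f P) (f Q).
Proof.
move=> [_ hf] hP /proj_eq_sym [c c0 eQ].
have hQ : on_curve (base_change iota E) Q by rewrite eQ; apply: on_curve_scale.
have [d [phi [hom ne loc]]] := hf _ hP.
apply: proj_eq_trans (loc _ hP ne) _; apply: proj_eq_sym.
have evQ : eval_triple iota phi Q = c ^+ d *: eval_triple iota phi P.
  by rewrite eQ (@eval_tripleZ _ d).
have cd0 : c ^+ d != 0 by rewrite expf_neq0.
apply: proj_eq_trans (loc _ hQ _) _; first by rewrite evQ scaler_eq0 negb_or cd0.
by exists (c ^+ d).
Qed.

Lemma regular_meval (W : weierstrass K) (p : {mpoly K[3]}) :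
  regular iota W (fun x y => (map_mpoly iota p).@[fun k => row3 x y 1 0 k]).
Proof.
elim/mpolyind: p => [|c m p _ _ IH].
  exists 0, 0 => x y _; by rewrite !rmorph0 horner0 mul0r addr0.
have reg_exp h n : regular iota W h -> regular iota W (fun x y => h x y ^+ n).
  move=> hr; elim: n => [|n [a [b IHn]]].
    exists 1, 0 => x y _.
    by rewrite expr0 rmorph0 rmorph1 -polyC1 hornerC horner0 mul0r addr0.
  have [a' [b' h2]] := regularM hr (ex_intro _ a (ex_intro _ b IHn)).
  by exists a', b' => x y hy; rewrite exprS -h2.
have hX : regular iota W (fun x _ => x) by do 2 eexists; apply: represents_x.
have hY : regular iota W (fun _ y => y) by do 2 eexists; apply: represents_y.
have hc : regular iota W (fun _ _ => iota c) by do 2 eexists; apply: represents_const.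
have [a [b h2]] := regularD
  (regularM hc (regularM (reg_exp _ (m cX) hX) (reg_exp _ (m cY) hY))) IH.
exists a, b => x y hy; rewrite -h2 // raddfD /= mevalD; congr (_ + _).
rewrite map_mpolyZ map_mpolyX /= mevalZ mevalX; congr (_ * _).
rewrite !big_ord_recl big_ord0 !mxE /= expr1n !mulr1.
by congr (_ ^+ m _ * _ ^+ m _); apply: val_inj.
Qed.

Definition chartX (f : 'rV[L]_3 -> 'rV[L]_3) (x y : L) : L :=
  f (row3 x y 1) 0 cX / f (row3 x y 1) 0 cZ.
Definition chartY (f : 'rV[L]_3 -> 'rV[L]_3) (x y : L) : L :=
  f (row3 x y 1) 0 cY / f (row3 x y 1) 0 cZ.

Definition affine_map E (f : 'rV[L]_3 -> 'rV[L]_3) : Prop :=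
  forall x y, affine iota E x y -> f (row3 x y 1) 0 cZ != 0.

Lemma chart_proj_eq f x y : f (row3 x y 1) 0 cZ != 0 ->
  proj_eq (f (row3 x y 1)) (row3 (chartX f x y) (chartY f x y) 1).
Proof.
move=> z0; exists (f (row3 x y 1) 0 cZ) => //.
rewrite {1}(row3_eta (f (row3 x y 1))) row3_scale mulr1 /chartX /chartY.
by congr row3; rewrite mulrCA divff // mulr1.
Qed.

Lemma chart_regular E E' f : curve_morphism iota E E' f -> affine_map E f ->
  regular iota E (chartX f) /\ regular iota E (chartY f).
Proof.
move=> [_ hf] fin.
have reg (j : 'I_3) : regular iota E (fun x y =>
    f (row3 x y 1) 0 j / f (row3 x y 1) 0 cZ).
  apply: regular_local => // x y hy.
  have hP : on_curve (base_change iota E) (row3 x y 1) by apply/on_curve_affine.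
  have [d [phi [_ ne loc]]] := hf _ hP.
  exists (fun x y => (map_mpoly iota (phi j)).@[fun k => row3 x y 1 0 k]).
  exists (fun x y => (map_mpoly iota (phi cZ)).@[fun k => row3 x y 1 0 k]).
  have evE x' y' k : (map_mpoly iota (phi k)).@[fun k => row3 x' y' 1 0 k]
     = eval_triple iota phi (row3 x' y' 1) 0 k by rewrite mxE.
  split; [exact: regular_meval | exact: regular_meval | |].
    have [c c0 e] := loc _ hP ne.
    have := fin _ _ hy; rewrite e evE coordZ mulf_eq0 negb_or => /andP[].
    by [].
  move=> x' y' hy'; rewrite !evE => B0.
  have hP' : on_curve (base_change iota E) (row3 x' y' 1) by apply/on_curve_affine.
  have [|c c0 e] := loc _ hP'.
    by apply: contraNneq B0 => ->; rewrite mxE.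
  rewrite e !coordZ.
  by rewrite invfM mulrACA divff // mul1r divfK.
by split; apply: reg.
Qed.

Lemma chart_affine E E' f : curve_morphism iota E E' f -> affine_map E f ->
  forall x y, affine iota E x y -> affine iota E' (chartX f x y) (chartY f x y).
Proof.
move=> [hf _] fin x y hy; apply/on_curve_affine.
have /proj_eq_sym [c c0 ->] := chart_proj_eq (fin _ _ hy).
by apply: on_curve_scale => //; apply/hf/on_curve_affine.
Qed.

Lemma chart_comp E E' f g : curve_morphism iota E E' f -> affine_map E f ->
  curve_morphism iota E' E g ->
  (forall P, on_curve (base_change iota E) P -> proj_eq (g (f P)) P) ->
  forall x y, affine iota E x y ->
  x = chartX g (chartX f x y) (chartY f x y) /\
  y = chartY g (chartX f x y) (chartY f x y).
Proof.
move=> hf fin hg gf x y hy.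
have hP : on_curve (base_change iota E) (row3 x y 1) by apply/on_curve_affine.
have := morphism_proj_eq hg (hf.1 _ hP) (chart_proj_eq (fin _ _ hy)).
move=> /proj_eq_sym /proj_eq_trans /(_ (gf _ hP)) [c c0 e].
have [hX hY hZ] := row3E x y 1.
rewrite /chartX /chartY -/(chartX f x y) -/(chartY f x y) e.
by rewrite !coordZ hX hY hZ mulr1 ![c * _]mulrC !mulfK.
Qed.

(** A point mapped to infinity has the same image as the origin, hence, applying
    the inverse g, is the origin. *)
Lemma iso_affine_map E E' f g : curve_morphism iota E E' f ->
  curve_morphism iota E' E g ->
  (forall P, on_curve (base_change iota E) P -> proj_eq (g (f P)) P) ->
  proj_eq (f (origin L)) (origin L) -> affine_map E f.
Proof.
move=> hf hg gf fO x y hy; apply/eqP => z0.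
have hP : on_curve (base_change iota E) (row3 x y 1) by apply/on_curve_affine.
have hO := on_curve_origin E.
have h1 := on_curve_infinity (hf.1 _ hP) z0.
have h2 := proj_eq_trans h1 (proj_eq_sym fO).
have h3 := morphism_proj_eq hg (hf.1 _ hP) h2.
have [c c0] := proj_eq_trans (proj_eq_sym (gf _ hP)) (proj_eq_trans h3 (gf _ hO)).
rewrite origin_row3 row3_scale !mulr0 => /rowP /(_ cZ); rewrite !mxE /= => /eqP.
by rewrite oner_eq0.
Qed.

(** The coordinates of f are regular functions al, be on E, and the inverse g
    expresses x and y as polynomials in them, so [affine_iso_change] applies. *)
Lemma isomorphic_weq E E' : isomorphic iota E E' -> weq E E'.
Proof.
move=> [f [g [hf hg gf fg fO]]].
have gO : proj_eq (g (origin L)) (origin L).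
  have hO := on_curve_origin E.
  apply: proj_eq_trans (gf _ hO).
  exact/proj_eq_sym/(morphism_proj_eq hg (hf.1 _ hO) fO).
have ff := iso_affine_map hf hg gf fO.
have gfin := iso_affine_map hg hf fg gO.
have [fX fY] := chart_regular hf ff.
have [[p [q gX]] [p' [q' gY]]] := chart_regular hg gfin.
have hc := chart_affine hf ff.
have comp := chart_comp hf ff hg gf.
have [|| u [r [s [t [u0 h]]]]] := affine_iso_change closedL fX fY hc (p := p) (q := q)
   (p' := p') (q' := q').
- by move=> x y hy; rewrite [LHS](comp _ _ hy).1 gX //; apply: hc.
- by move=> x y hy; rewrite [LHS](comp _ _ hy).2 gY //; apply: hc.
- by apply: weq_sym; exists u, r, s, t.
Qed.

Lemma isomorphicP E E' : isomorphic iota E E' <-> weq E E'.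
Proof. by split; [exact: isomorphic_weq | exact: weq_isomorphic]. Qed.

End MorphismCharts.

(** * A separable closure of a finite field is algebraically closed *)

Section SeparableClosureOfFiniteField.
Local Open Scope ring_scope.

Lemma pFrobenius_iter_inj (L : fieldType) (p k : nat) (x y : L) :
  p \in [pchar L] -> x ^+ (p ^ k) = y ^+ (p ^ k) -> x = y.
Proof.
move=> hp; elim: k => [|k IH]; first by rewrite expn0 !expr1.
rewrite expnSr !exprM -!(pFrobenius_autE hp) => /fmorph_inj; exact: IH.
Qed.

(** The powers x^(p^n) lie in the finite ring F[x], so two of them coincide;
    injectivity of Frobenius then gives x = x^(p^m) for some m > 0. *)
Lemma separable_closure_perfect (F : finFieldType) (L : fieldType)
    (iota : {rmorphism F -> L}) (p : nat) :
  separable_closure iota -> p \in [pchar L] -> forall x : L, exists y, x = y ^+ p.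
Proof.
move=> [alg _] hp x; have [P sepP rootP] := alg x.
have P0 : P != 0 by apply: separable_poly_neq0.
pose s := size P.
pose f (n : nat) : {ffun 'I_s -> F} := [ffun i : 'I_s => ('X^(p ^ n) %% P)`_i].
have fE n m : f n = f m -> x ^+ (p ^ n) = x ^+ (p ^ m).
  move=> /ffunP e.
  have pw k : x ^+ k = (map_poly iota ('X^k %% P)).[x].
    have := congr1 (fun q => (map_poly iota q).[x]) (divp_eq 'X^k P).
    rewrite rmorphD rmorphM /= map_polyXn hornerD hornerM hornerXn => ->.
    by move/eqP: rootP => ->; rewrite mulr0 add0r.
  rewrite !pw; congr (map_poly iota _).[x].
  apply/polyP => i; have [lt|ge] := ltnP i s; first by have := e (Ordinal lt); rewrite !ffunE.
  by rewrite !nth_default // (leq_trans _ ge) // ltnW // ltn_modp.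
have : ~~ injectiveb (fun i : 'I_(#|{ffun 'I_s -> F}|.+1) => f i).
  by apply/negP => /injectiveP /leq_card; rewrite card_ord ltnn.
case/injectivePn => i [j ne eij].
wlog lt : i j ne eij / (i < j)%N.
  move=> h; case: (ltngtP i j) => [lt|lt|/val_inj e]; first exact: (h i j).
  - by apply: (h j i) => //; rewrite eq_sym.
  - by rewrite e eqxx in ne.
exists (x ^+ (p ^ (j - i).-1)); apply: (pFrobenius_iter_inj (k := i) hp).
by rewrite -!exprM -?mulnA -expnS -expnD (fE _ _ eij); congr (_ ^+ (p ^ _)); lia.
Qed.

Lemma poly_pth_power (L : fieldType) (p : nat) : p \in [pchar L] ->
  (forall x : L, exists y, x = y ^+ p) ->
  forall P : {poly L}, P^`() = 0 -> exists Q, P = Q ^+ p.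
Proof.
move=> hp perf P dP; have p0 := prime_gt0 (pcharf_prime hp).
have /boolp.choice [r hr] := perf.
(* Only the coefficients of degree divisible by p survive in P. *)
pose Q := \sum_(i < size P) (r P`_(i * p)) *: 'X^i.
have hpp : p \in [pchar {poly L}] by rewrite pchar_poly.
exists Q; rewrite -(pFrobenius_autE hpp) rmorph_sum /=.
under eq_bigr => i _ do rewrite pFrobenius_autE exprZn -hr -exprM.
apply/polyP => k; rewrite coef_sum.
under eq_bigr => i _ do rewrite coefZ coefXn.
have [/dvdnP [m ->]|ndvd] := boolP (p %| k)%N.
  have [lt|ge] := ltnP m (size P).
    rewrite (bigD1 (Ordinal lt)) //= eqxx mulr1 big1 ?addr0 // => i ne.
    rewrite eqn_pmul2r //; case: eqP => [e|]; last by rewrite mulr0.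
    by case/eqP: ne; apply: val_inj.
  rewrite nth_default; last by rewrite (leq_trans ge) // leq_pmulr.
  rewrite big1 // => i _; rewrite eqn_pmul2r //.
  by case: eqP => [e|]; rewrite ?mulr0 //; move: (ltn_ord i); rewrite -e ltnNge ge.
rewrite big1 => [|i _]; last first.
  case: eqP => [e|]; last by rewrite mulr0.
  by move: ndvd; rewrite e dvdn_mull.
case: k ndvd => [|k] ndvd; first by rewrite dvdn0 in ndvd.
have /eqP := congr1 (fun R : {poly L} => R`_k) dP.
rewrite coef_deriv coef0 -mulr_natr mulf_eq0 => /orP[/eqP->//|].
by rewrite -(dvdn_pcharf hp) (negPf ndvd).
Qed.

(** By induction on the size of P: if P' = 0 then P is a p-th power; otherwise P is
    separable, or gcd(P, P') is a proper factor that is not constant. *)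
Lemma separable_closure_closed (F : finFieldType) (L : fieldType)
    (iota : {rmorphism F -> L}) : separable_closure iota ->
  forall P : {poly L}, (1 < size P)%N -> exists x, root P x.
Proof.
move=> hL; have [p pp hp0] := finPcharP F.
have hp : p \in [pchar L] by rewrite (fmorph_pchar iota).
have perf := separable_closure_perfect hL hp.
move=> P; have [n] := ubnP (size P); elim: n P => // n IH P leP sP.
have [dP|dP] := eqVneq P^`() 0.
  have [Q eQ] := poly_pth_power hp perf dP.
  have Q1 : (1 < size Q)%N.
    rewrite ltnNge; apply/negP => /size1_polyC e; move: sP.
    rewrite eQ e -polyC_exp => /leq_trans /(_ (size_polyC_leq1 _)); by rewrite ltnn.
  have [|x rx] := IH Q _ Q1; last first.
    by exists x; rewrite eQ /root horner_exp (eqP rx) expr0n; case: (p) (prime_gt0 pp).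
  have sQ : (size P).-1 = ((size Q).-1 * p)%N by rewrite eQ size_exp.
  have := prime_gt1 pp; move: leP sP Q1 sQ; move: (size P) (size Q) => u v; nia.
have [sg|sg] := boolP (separable_poly P); first by apply: hL.2.
have [g1|g1] := leqP (size (gcdp P P^`())) 1.
  case/negP: sg; rewrite unlock /coprimep eqn_leq g1 size_poly_gt0.
  by rewrite gcdp_eq0 negb_and dP orbT.
have [|x rx] := IH _ _ g1; last first.
  have /dvdpP [c e] := dvdp_gcdl P P^`().
  by exists x; rewrite e rootM rx orbT.
have h1 := leq_gcdpr P dP.
have P0 : P != 0 by rewrite -size_poly_gt0 (ltn_trans _ sP).
have := leq_ltn_trans h1 (lt_size_deriv P0) => h2.
exact: leq_trans h2 _.
Qed.

End SeparableClosureOfFiniteField.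

(** * Normal forms in characteristic two *)

Section DiscriminantInvariance.
Local Open Scope ring_scope.

Lemma change_disc (K : fieldType) (u r s t : K) (W W' : weierstrass K) :
  u != 0 -> coord_change u r s t W W' -> u ^+ 12 * disc W' = disc W.
Proof.
case: W W' => [b1 b2 b3 b4 b6] [d1 d2 d3 d4 d6] u0 [] /=.
rewrite -[in u * _](expr1 u).
move=> /(solve_unit u0)-> /(solve_unit u0)-> /(solve_unit u0)->.
move=> /(solve_unit u0)-> /(solve_unit u0)->.
by rewrite /disc /Defs.b2 /Defs.b4 /Defs.b6 /b8 /=; field.
Qed.

Lemma weq_disc (K : fieldType) (W W' : weierstrass K) :
  weq W W' -> disc W != 0 -> disc W' != 0.
Proof.
move=> [u [r [s [t [u0 /(change_disc u0)<-]]]]].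
by rewrite mulf_eq0 negb_or => /andP[].
Qed.
End DiscriminantInvariance.

Section CharacteristicTwo.
Local Open Scope ring_scope.
Variable (K : fieldType) (K2 : 2 \in [pchar K]).
Implicit Types (W : weierstrass K) (u r s t x y : K).

Lemma nat2_eq0 : 2 = 0 :> K. Proof. exact: pcharf0 K2. Qed.

Lemma subr_pchar2 x y : x - y = x + y.
Proof. by rewrite (oppr_pchar2 K2). Qed.

(** An identity that holds only modulo 2 becomes an integral identity once the
    multiple 2 z of 2 is made explicit. *)
Lemma eq_mod2 x y z : x = y + 2 * z -> x = y.
Proof. by rewrite nat2_eq0 mul0r addr0. Qed.

Lemma addr_eq_pchar2 x y z : x + y = z <-> x = z + y.
Proof.
by split=> [<-|->]; rewrite -addrA (addrr_pchar2 K2) addr0.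
Qed.

Lemma sqrrD_pchar2 x y : (x + y) ^+ 2 = x ^+ 2 + y ^+ 2.
Proof. by apply: (@eq_mod2 _ _ (x * y)); ring. Qed.

Lemma c4_pchar2 W : c4 W = a1 W ^+ 4.
Proof.
apply: (@eq_mod2 _ _ (4 * a1 W ^+ 2 * a2 W + 8 * a2 W ^+ 2 - 12 * b4 W)).
by rewrite /c4 /b2; ring.
Qed.

Lemma disc_pchar2 W : disc W = a1 W ^+ 4 * b8 W + a3 W ^+ 4 + a1 W ^+ 3 * a3 W ^+ 3.
Proof.
apply: (@eq_mod2 _ _ (- (a1 W ^+ 4 * b8 W) - (4 * a1 W ^+ 2 * a2 W + 8 * a2 W ^+ 2) * b8 W
  - 4 * b4 W ^+ 3 - 14 * a3 W ^+ 4 - 27 * (4 * a3 W ^+ 2 * a6 W + 8 * a6 W ^+ 2)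
  + 4 * a1 W ^+ 3 * a3 W ^+ 3
  + 9 * (a1 W ^+ 2 * a4 W * a3 W ^+ 2
  + a1 W ^+ 2 * b4 W * 2 * a6 W + 2 * a2 W * b4 W * b6 W))).
by rewrite /disc /b2 /b4 /b6; ring.
Qed.

Lemma j_invariant_eq0 (E : elliptic_curve K) : (j_invariant E == 0) = (a1 E == 0).
Proof.
rewrite /j_invariant mulf_eq0 invr_eq0 (negPf (disc_neq0 E)) orbF.
by rewrite c4_pchar2 -exprM expf_eq0.
Qed.

Lemma change_pchar2 u r s t W W' : coord_change u r s t W W' <->
  [/\ u * a1 W' = a1 W,
      u ^+ 2 * a2 W' = a2 W + s * a1 W + r + s ^+ 2,
      u ^+ 3 * a3 W' = a3 W + r * a1 W,
      u ^+ 4 * a4 W' = a4 W + s * a3 W + (t + r * s) * a1 W + r ^+ 2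
    & u ^+ 6 * a6 W' = a6 W + r * a4 W + r ^+ 2 * a2 W + r ^+ 3
                       + t * a3 W + t ^+ 2 + r * t * a1 W].
Proof.
have three : 3 = 1 :> K by apply: (@eq_mod2 _ _ 1); ring.
rewrite /coord_change three nat2_eq0 !subr_pchar2 !mul0r !addr0 !mul1r.
by rewrite ?addr0.
Qed.

Definition ordinary (x y : K) : weierstrass K := Weierstrass 1 x 0 0 y.
(** In characteristic two an elliptic curve has a point of order 2 over an
    algebraically closed field exactly when a1 is nonzero; hence the names. *)
Definition supersingular (a b c : K) : weierstrass K := Weierstrass 0 0 a b c.

Lemma disc_ordinary x y : disc (ordinary x y) = y.
Proof. by rewrite disc_pchar2 /b8 /=; apply: (@eq_mod2 _ _ (2 * x * y)); ring. Qed.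

Lemma disc_supersingular a b c : disc (supersingular a b c) = a ^+ 4.
Proof. by rewrite disc_pchar2 /b8 /=; ring. Qed.

(** Scale a1 to 1, translate X to remove a3 and Y to remove a4. *)
Lemma weq_ordinary W : a1 W != 0 -> exists x y, weq W (ordinary x y).
Proof.
case: W => [b1 b2 b3 b4 b6] /= u0.
pose r := b3 / b1; pose t := (b4 + r ^+ 2) / b1.
exists ((b2 + r) / b1 ^+ 2), ((b6 + r * b4 + r ^+ 2 * b2 + r ^+ 3
                       + t * b3 + t ^+ 2 + r * t * b1) / b1 ^+ 6).
exists b1, r, 0, t; split=> //; apply/change_pchar2; split=> /=.
- by rewrite mulr1.
- by rewrite mulrC divfK ?expf_neq0 //; ring.
- apply: (@eq_mod2 _ _ (- b3)); by rewrite /r; field.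
- apply: (@eq_mod2 _ _ (- b4 - r ^+ 2)); by rewrite /t; field.
- by rewrite mulrC divfK ?expf_neq0.
Qed.

(** The zero coefficients force u = 1 and r = t = 0. *)
Lemma weq_ordinaryE x y x' y' :
  weq (ordinary x y) (ordinary x' y') <-> y = y' /\ exists s, x' = x + (s ^+ 2 + s).
Proof.
split=> [[u [r [s [t [_ /change_pchar2 []]]]]]|[-> [s ->]]]; last first.
  exists 1, 0, s, 0; split; first exact: oner_neq0.
  by apply/change_pchar2; split=> /=; ring.
rewrite /= mulr1 => -> e2 e3 e4 e6.
have r0 : r = 0 by move: e3; rewrite mulr0 add0r mulr1.
have t0 : t = 0 by move: e4; rewrite r0; rewrite mulr0 => e4; rewrite [RHS]e4; ring.
move: e2 e6; rewrite r0 t0 => e2 e6; split; last first.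
  by exists s; move: e2; rewrite expr1n mul1r => ->; ring.
by move: e6; rewrite expr1n mul1r => ->; ring.
Qed.

Lemma weq_supersingular W : a1 W = 0 -> exists a b c, weq W (supersingular a b c).
Proof.
case: W => [b1 b2 b3 b4 b6] /= ->.
exists b3, (b4 + b2 ^+ 2), (b6 + b2 * b4).
exists 1, b2, 0, 0; split; first exact: oner_neq0.
apply/change_pchar2; split=> /=; try ring.
- by apply: (@eq_mod2 _ _ (- b2)); ring.
- by apply: (@eq_mod2 _ _ (- b2 ^+ 3)); ring.
Qed.

(** The vanishing coefficient a2 forces r = s^2. *)
Lemma weq_supersingularE a b c a' b' c' :
  weq (supersingular a b c) (supersingular a' b' c') <->
  exists u s t, [/\ u != 0, u ^+ 3 * a' = a, u ^+ 4 * b' = b + (s ^+ 4 + a * s)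
    & u ^+ 6 * c' = c + s ^+ 2 * b + s ^+ 6 + (t ^+ 2 + a * t)].
Proof.
split=> [[u [r [s [t [u0 /change_pchar2 []]]]]]|[u [s [t [u0 e3 e4 e6]]]]] /=.
  rewrite !mulr0 !addr0 add0r => _ /esym /addr_eq_pchar2; rewrite add0r => -> e3 e4 e6.
  exists u, s, t; split=> //; first by rewrite e4; ring.
  by rewrite e6; ring.
exists u, (s ^+ 2), s, t; split=> //; apply/change_pchar2; split=> /=.
- by ring.
- by apply: (@eq_mod2 _ _ (- s ^+ 2)); ring.
- by rewrite e3; ring.
- by rewrite e4; ring.
- by rewrite e6; ring.
Qed.

End CharacteristicTwo.

Section ClosedCharacteristicTwo.
Local Open Scope ring_scope.
Variable (L : fieldType) (L2 : 2 \in [pchar L]).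
Hypothesis closedL : forall p : {poly L}, (1 < size p)%N -> exists x, root p x.

(** Existence of the parameters u, s and t over an algebraically closed field. *)
Lemma closed_trinomial (k : nat) (b c : L) : (1 < k)%N ->
  exists x, x ^+ k + b * x = c.
Proof.
move=> k1; pose p : {poly L} := 'X^k + (b *: 'X - c%:P).
have sp : size p = k.+1.
  rewrite size_polyDl size_polyXn // ltnS (leq_trans (size_polyD _ _)) // geq_max.
  rewrite size_polyN (leq_trans (size_polyC_leq1 c) (ltnW k1)) andbT.
  by rewrite (leq_trans (size_scale_leq _ _)) ?size_polyX.
have [|x /rootP] := closedL (p := p); first by rewrite sp ltnS ltnW.
rewrite !(hornerD, hornerN, hornerZ, hornerXn, hornerX, hornerC) => e.
by exists x; apply/eqP; rewrite -subr_eq0 -addrA e.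
Qed.

Lemma weq_supersingular_closed (a b c a' b' c' : L) : a != 0 -> a' != 0 ->
  weq (supersingular a b c) (supersingular a' b' c').
Proof.
move=> a0 a0'; apply/(weq_supersingularE L2).
have [u hu] := @closed_trinomial 3 0 (a / a') isT.
have [s hs] := @closed_trinomial 4 a (b + u ^+ 4 * b') isT.
have [t ht] := @closed_trinomial 2 a (u ^+ 6 * c' + (c + s ^+ 2 * b + s ^+ 6)) isT.
move: hu; rewrite mul0r addr0 => hu.
exists u, s, t; split.
- apply: contra_neq a0 => u0; move: hu; rewrite u0 expr0n => /esym/eqP.
  by rewrite mulf_eq0 invr_eq0 (negPf a0') orbF => /eqP.
- by rewrite hu divfK.
- by rewrite hs; apply: (@eq_mod2 _ L2 _ _ (- b)); ring.
- by rewrite ht; apply: (@eq_mod2 _ L2 _ _ (- (c + s ^+ 2 * b + s ^+ 6))); ring.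
Qed.

Lemma weq_ordinary_closed (x x' y : L) : weq (ordinary x y) (ordinary x' y).
Proof.
have [s hs] := @closed_trinomial 2 1 (x' - x) isT.
apply/(weq_ordinaryE L2); split=> //; exists s.
by move: hs; rewrite mul1r => ->; ring.
Qed.

End ClosedCharacteristicTwo.

(** * Finite fields of characteristic two *)

Section FiniteFieldCosets.
Local Open Scope ring_scope.

Lemma finField_primitive_root (F : finFieldType) :
  exists g : F, (#|F|.-1).-primitive_root g.
Proof.
have F1 : (1 < #|F|)%N := finNzRing_gt1 F.
pose rs := [seq x : F <- enum F | x != 0].
have : has (#|F|.-1).-primitive_root rs.
  apply: has_prim_root.
  - by rewrite -subn1 subn_gt0.
  - apply/allP => x; rewrite mem_filter => /andP[x0 _].
    by apply/unity_rootP/(mulfI x0); rewrite -exprS prednK ?(ltnW F1) // expf_card mulr1.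
  - by rewrite filter_uniq ?enum_uniq.
  - rewrite -(cardC1 (0 : F)) cardE uniq_leq_size ?enum_uniq // => x.
    by rewrite mem_enum mem_filter mem_enum !inE andbT.
by case/hasP => g _ hg; exists g.
Qed.

Section AdditiveCokernel.
Variables (V : finZmodType) (phi : V -> V).
Hypothesis phiD : {morph phi : x y / x + y}.

Let phiB x y : phi (x - y) = phi x - phi y.
Proof. by apply: (addIr (phi y)); rewrite -phiD !subrK. Qed.

Lemma card_image_kernel : (#|phi @: [set: V]| * #|[set x | phi x == 0%R]|)%N = #|V|.
Proof.
rewrite -cardsT -[RHS]sum1_card (partition_big_imset phi) /= -sum_nat_const.
apply: eq_bigr => _ /imsetP [x0 _ ->].
rewrite sum1dep_card -[LHS](card_imset _ (addrI x0)); apply: eq_card => x.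
apply/imsetP/idP => [[y]|]; rewrite !inE.
  by move=> /eqP hy ->; rewrite phiD hy addr0 eqxx.
move=> /eqP e; exists (x - x0); last by rewrite addrC subrK.
by rewrite inE phiB e subrr.
Qed.

(** A set D of elements that are incongruent modulo the image of phi and as
    numerous as the kernel is a full system of representatives of the cokernel. *)
Lemma additive_cokernel (D : {set V}) :
  (forall d e x, d \in D -> e \in D -> d = e + phi x -> d = e) ->
  #|[set x | phi x == 0]| = #|D| ->
  forall a, exists2 d, d \in D & exists x, a = d + phi x.
Proof.
move=> hD cD a.
pose f (p : V * V) := p.1 + p.2.
have inj : {in finset.setX D (phi @: [set: V]) &, injective f}.
  move=> [d y] [e z]; rewrite !inE /= => /andP[hd /imsetP[x _ ->]] /andP[he /imsetP[x' _ ->]].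
  rewrite /f /= => e1; have de : d = e.
    apply: (hD _ _ (x' - x)) => //; rewrite phiB addrA -e1 addrK //.
  by move: e1; rewrite de => /addrI ->.
have : a \in f @: finset.setX D (phi @: [set: V]).
  suff -> : f @: finset.setX D (phi @: [set: V]) = [set: V] by rewrite inE.
  apply/eqP; rewrite eqEcard finset.subsetT card_in_imset // cardsX cardsT -cD mulnC.
  by rewrite card_image_kernel /=.
case/imsetP => [[d y]]; rewrite !inE /= => /andP[hd /imsetP [x _ ->]] ->.
by exists d => //; exists x.
Qed.

End AdditiveCokernel.

(** Applied below to the additive maps t^2 + c t and s^4 + s, which have a
    nontrivial kernel. *)
Lemma not_injective_not_onto (T : finType) (f : T -> T) (x y : T) :
  x != y -> f x = f y -> exists w, forall z, w <> f z.
Proof.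
move=> ne e; have [/forallP h|] := boolP [forall w, w \in codom f]; last first.
  rewrite negb_forall => /existsP [w hw]; exists w => z ez.
  by move: hw; rewrite ez codom_f.
have : injectiveb f.
  rewrite /injectiveb /dinjectiveb; apply/card_uniqP; rewrite size_map -cardE.
  by apply: eq_card => w; rewrite !inE [LHS]h.
by move/injectiveP => /(_ _ _ e) /eqP; rewrite (negPf ne).
Qed.

End FiniteFieldCosets.

Section CharacteristicTwoFiniteField.
Local Open Scope ring_scope.
Variables (F : finFieldType) (F2 : 2 \in [pchar F]).
Implicit Types a b c u v w s t z : F.

Lemma addr_eq0_pchar2 (x y : F) : (x + y == 0) = (x == y).
Proof. by rewrite -(subr_pchar2 F2) subr_eq0. Qed.

Lemma sqr_addD c : {morph (fun t => t ^+ 2 + c * t) : x y / x + y}.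
Proof. by move=> x y; rewrite (sqrrD_pchar2 F2); ring. Qed.

Lemma quartic_addD c : {morph (fun t => t ^+ 4 + c * t) : x y / x + y}.
Proof.
move=> x y; have e (z : F) : z ^+ 4 = (z ^+ 2) ^+ 2 by rewrite -exprM.
by rewrite !e !(sqrrD_pchar2 F2); ring.
Qed.

Lemma sqr_add_not_onto c : c != 0 -> exists w, forall t, w <> t ^+ 2 + c * t.
Proof.
move=> c0; apply: (@not_injective_not_onto _ (fun t => t ^+ 2 + c * t) 0 c).
  by rewrite eq_sym.
by apply: (@eq_mod2 _ F2 _ _ (- c ^+ 2)); ring.
Qed.

(** The kernel of t^2 + c t is {0, c}, so its image has index 2. *)
Lemma sqr_add_cokernel c w a : c != 0 -> (forall t, w <> t ^+ 2 + c * t) ->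
  exists t, a = t ^+ 2 + c * t \/ a = w + (t ^+ 2 + c * t).
Proof.
move=> c0 hw; have w0 : w != 0.
  by apply/eqP => w0; apply: (hw 0); rewrite w0; ring.
have [||d + [t ->]] := additive_cokernel (sqr_addD c) (D := [set 0; w]) _ _ a.
- move=> d e x; rewrite !inE => /orP[]/eqP-> /orP[]/eqP-> //.
    by move=> e1; case: (hw x); apply/eqP; rewrite -addr_eq0_pchar2 -e1.
  by rewrite add0r => /hw.
- transitivity #|([set 0; c] : {set F})|; last by rewrite !cards2 !(eq_sym 0) w0 c0.
  apply: eq_card => x; rewrite !inE -(addr_eq0_pchar2 x c) -mulf_eq0.
  by congr (_ == _); ring.
- by rewrite !inE => /orP[]/eqP->; exists t; [left; rewrite add0r | right].
Qed.

Lemma cube_eq z : z ^+ 3 = 1 -> z = 1 \/ z ^+ 2 + z + 1 = 0.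
Proof.
move=> z3; have /eqP : (z - 1) * (z ^+ 2 + z + 1) = 0.
  by transitivity (z ^+ 3 - 1); [ring | rewrite z3 subrr].
by rewrite mulf_eq0 subr_eq0 => /orP[]/eqP; [left|right].
Qed.

Lemma cube_onto : (forall z, z ^+ 2 + z + 1 <> 0) -> forall a, exists u, u ^+ 3 = a.
Proof.
move=> nz a; have inj : injective (fun u : F => u ^+ 3).
  move=> u v; have [->|v0] := eqVneq v 0.
    by rewrite (expr0n _ 3) => /eqP; rewrite expf_eq0 => /eqP.
  move=> e; have [|h|/nz//] := @cube_eq (u / v).
    by rewrite expr_div_n e divff // expf_neq0.
  by rewrite -(divfK v0 u) h mul1r.
by have /codomP [u ->] := inj_card_onto inj (leqnn _) a; exists u.
Qed.

(** A primitive cube root of unity makes 3 divide the order of the cyclic group of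
    nonzero elements; c is a generator of that group. *)
Lemma exists_noncube z : z ^+ 2 + z + 1 = 0 -> exists c,
  (forall u, u ^+ 3 <> c) /\
  forall a, a != 0 -> exists u i, [/\ u != 0, (i < 3)%N & a = u ^+ 3 * c ^+ i].
Proof.
move=> hz; have [g hg] := finField_primitive_root F.
have F1 : (1 < #|F|)%N := finNzRing_gt1 F.
have pw a : a != 0 -> exists k, a = g ^+ k.
  move=> a0; have [|i ->] := prim_rootP hg (x := a); last by exists i.
  by apply: (mulfI a0); rewrite -exprS prednK ?(ltnW F1) // expf_card mulr1.
have g0 : g != 0.
  apply/eqP => g0; have := prim_expr_order hg; rewrite g0 expr0n.
  by case: eqP => [|_ /esym/eqP]; [lia | rewrite oner_eq0].
have z0 : z != 0.
  by apply: contra_eq_neq hz => ->; rewrite expr0n !add0r oner_eq0.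
have z3 : z ^+ 3 = 1.
  apply/eqP; rewrite -subr_eq0; apply/eqP.
  by rewrite -[RHS](mulr0 (z - 1)) -hz; ring.
have z1 : z != 1.
  apply: contra_eq_neq hz => ->; rewrite expr1n.
  by rewrite (addrr_pchar2 F2) add0r oner_eq0.
have d3 : (3 %| #|F|.-1)%N.
  have [k ek] := pw _ z0.
  have : (#|F|.-1 %| k * 3)%N by rewrite (prim_order_dvd hg) exprM -ek z3.
  apply: contraLR => nd.
  have co : coprime #|F|.-1 3 by rewrite coprime_sym prime_coprime.
  rewrite Gauss_dvdl //; apply: contra z1.
  by rewrite (prim_order_dvd hg) -ek.
exists g; split=> [u e|a a0].
  have u0 : u != 0 by apply: contra_eq_neq e => ->; rewrite expr0n eq_sym.
  have [k ek] := pw _ u0.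
  have : (k * 3 == 1 %[mod #|F|.-1])%N.
    by rewrite -(eq_prim_root_expr hg) exprM -ek e expr1.
  move/eqP => /(congr1 (modn^~ 3)); rewrite !modn_dvdm // modnMl.
  by rewrite modn_small.
have [k ->] := pw _ a0.
exists (g ^+ (k %/ 3)), (k %% 3)%N; split; [by rewrite expf_neq0 | by rewrite ltn_mod|].
by rewrite -exprM -exprD -divn_eq.
Qed.

(** Here 2^n is 2 modulo 3, so z^3 = 1 gives z = z^(2^n) = z^2, that is z = 1. *)
Lemma cube_root_unity_odd n : #|F| = (2 ^ n)%N -> odd n -> forall z, z ^+ 2 + z + 1 <> 0.
Proof.
move=> hq on z hz.
have z3 : z ^+ 3 = 1.
  apply/eqP; rewrite -subr_eq0; apply/eqP.
  by rewrite -[RHS](mulr0 (z - 1)) -hz; ring.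
have e := expf_card z; move: e; rewrite hq.
have -> : (2 ^ n = 2 + ((2 ^ n) %/ 3) * 3)%N.
  have h : (2 ^ n %% 3 = 2)%N.
    rewrite -(odd_double_half n) on expnD expn1 -mul2n expnM.
    by rewrite -modnMmr -modnXm exp1n.
  by rewrite [LHS](divn_eq _ 3) h addnC.
rewrite exprD mulnC exprM z3 expr1n mulr1 => e.
by move: hz; rewrite e (addrr_pchar2 F2) add0r => /eqP; rewrite oner_eq0.
Qed.

(** Here 3 divides 2^n - 1, so a generator has a power of order 3. *)
Lemma cube_root_unity_even n : #|F| = (2 ^ n)%N -> ~~ odd n -> exists z, z ^+ 2 + z + 1 = 0.
Proof.
move=> hq on; have [g hg] := finField_primitive_root F.
have F1 : (1 < #|F|)%N := finNzRing_gt1 F.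
have d3 : (3 %| #|F|.-1)%N.
  have h : (2 ^ n %% 3 = 1)%N.
    by rewrite -(odd_double_half n) (negPf on) add0n -mul2n expnM -modnXm exp1n.
  by rewrite -subn1 hq -eqn_mod_dvd ?expn_gt0 // h.
exists (g ^+ (#|F|.-1 %/ 3)).
have [||//] := @cube_eq (g ^+ (#|F|.-1 %/ 3)).
  by rewrite -exprM divnK // (prim_expr_order hg).
move/eqP; rewrite -(prim_order_dvd hg) => /dvdn_leq.
case/dvdnP: d3 => m em; move: F1; lia.
Qed.

End CharacteristicTwoFiniteField.

(** * Classes of curves with vanishing invariant *)

Section SupersingularClasses.
Local Open Scope ring_scope.
Variables (F : finFieldType) (F2 : 2 \in [pchar F]).
Implicit Types a b c d u v w s t z : F.
Local Notation SS := supersingular.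

Lemma ss_scale u a b c : u != 0 ->
  weq (SS (u ^+ 3 * a) b c) (SS a (b / u ^+ 4) (c / u ^+ 6)).
Proof.
move=> u0; apply/(weq_supersingularE F2); exists u, 0, 0; split=> //.
- by rewrite mulrC divfK ?expf_neq0 //; ring.
- by rewrite mulrC divfK ?expf_neq0 //; ring.
Qed.

Lemma ss_shift4 s a b c d : b = d + (s ^+ 4 + a * s) ->
  exists c', weq (SS a b c) (SS a d c').
Proof.
move=> ->; eexists; apply/(weq_supersingularE F2).
exists 1, s, 0; split; first exact: oner_neq0.
- by rewrite expr1n mul1r.
- by apply: (@eq_mod2 _ F2 _ _ (- (s ^+ 4 + a * s))); ring.
- by rewrite expr1n mul1r.
Qed.

Lemma ss_shift6 t a b c d : c = d + (t ^+ 2 + a * t) -> weq (SS a b c) (SS a b d).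
Proof.
move=> ->; apply/(weq_supersingularE F2).
exists 1, 0, t; split; first exact: oner_neq0.
- by rewrite expr1n mul1r.
- by ring.
- by apply: (@eq_mod2 _ F2 _ _ (- (t ^+ 2 + a * t))); ring.
Qed.

(** A coordinate change preserving a and b that may still move c. *)
Lemma ss_stab s a b c : s ^+ 4 + a * s = 0 ->
  weq (SS a b c) (SS a b (c + s ^+ 2 * b + s ^+ 6)).
Proof.
move=> e; apply/(weq_supersingularE F2).
exists 1, s, 0; split; first exact: oner_neq0.
- by rewrite expr1n mul1r.
- by rewrite e; ring.
- by ring.
Qed.

(** The map s^4 + s is the square, under composition, of t^2 + t. *)
Lemma quartic_sqr s : s ^+ 4 + 1 * s = (s ^+ 2 + 1 * s) ^+ 2 + 1 * (s ^+ 2 + 1 * s).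
Proof. by apply: (@eq_mod2 _ F2 _ _ (- s ^+ 3 - s ^+ 2)); ring. Qed.

Lemma quartic_eq0 s : s ^+ 4 + 1 * s = 0 -> s = 0 \/ s ^+ 3 = 1.
Proof.
move=> e; have /eqP : s * (s ^+ 3 + 1) = 0 by rewrite -[RHS]e; ring.
by rewrite mulf_eq0 addr_eq0_pchar2 // => /orP[]/eqP; [left|right].
Qed.

(** With 1 as representative of the cokernels of both t^2 + t and s^4 + s. *)
Definition odd_classes : seq (weierstrass F) := [:: SS 1 0 0; SS 1 1 0; SS 1 1 1].

Section OddDegree.
Hypothesis no_z : forall z, z ^+ 2 + z + 1 <> 0.

Let not_AS t : 1 <> t ^+ 2 + 1 * t.
Proof.
rewrite mul1r => e; apply: (no_z (z := t)).
by rewrite -e (addrr_pchar2 F2).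
Qed.

Let not_quartic s : 1 <> s ^+ 4 + 1 * s.
Proof. by rewrite quartic_sqr; apply: not_AS. Qed.

Let cube1 u : u ^+ 3 = 1 -> u = 1.
Proof. by case/cube_eq => // /no_z. Qed.

(** Cubing is onto, so a can be scaled to 1; then s^4 + s brings b to 0 or 1 and
    t^2 + t brings c to 0 or 1.  For b = 0 the change s = 1 adds 1 to c and merges
    the two values. *)
Lemma odd_classes_cover a b c : a != 0 ->
  exists i, (i < 3)%N /\ weq (nth (SS a b c) odd_classes i) (SS a b c).
Proof.
move=> a0; have [u hu] := cube_onto no_z a.
have u0 : u != 0 by apply: contra_neq a0 => u0; rewrite -hu u0 expr0n.
suff : exists i, (i < 3)%N /\ weq (SS a b c) (nth (SS a b c) odd_classes i).
  by move=> [i [hi /weq_sym h]]; exists i.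
suff : forall b' c' W, exists i, (i < 3)%N /\ weq (SS 1 b' c') (nth W odd_classes i).
  move=> /(_ (b / u ^+ 4) (c / u ^+ 6) (SS a b c)) [i [hi h]]; exists i; split=> //.
  by apply: weq_trans h; rewrite -{1}hu -[u ^+ 3]mulr1; apply: ss_scale.
move=> {a b c u a0 hu u0} b c W.
have [||d + [s hs]] := additive_cokernel (quartic_addD F2 1) (D := [set 0; 1]) _ _ b.
- move=> d e x; rewrite !inE => /orP[]/eqP-> /orP[]/eqP-> //.
    by move=> e1; case: (not_quartic (s := x)); apply/eqP; rewrite -addr_eq0_pchar2 // -e1.
  by rewrite add0r => /not_quartic.
- apply: eq_card => x; rewrite !inE; apply/eqP/orP => [/quartic_eq0[->|/cube1->]|[]/eqP->].
  + by left.
  + by right.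
  + by ring.
  + by apply: (@eq_mod2 _ F2 _ _ 1); ring.
have [c' hc] := ss_shift4 c hs.
have AS1 := sqr_add_cokernel F2 c' (oner_neq0 F) not_AS.
rewrite !inE => /orP[]/eqP d0; subst d.
  exists 0%N; split=> //=; apply: weq_trans hc _.
  have [t [e|e]] := AS1; first by apply: (ss_shift6 (t := t)); rewrite e add0r.
  have h1 := @ss_stab 1 1 0 c'.
  apply: weq_trans (h1 _) _; first by apply: (@eq_mod2 _ F2 _ _ 1); ring.
  apply: (ss_shift6 (t := t)); rewrite e.
  by apply: (@eq_mod2 _ F2 _ _ 1); ring.
have [t [e|e]] := AS1; [exists 1%N|exists 2%N]; split=> //=; apply: weq_trans hc _;
  by apply: (ss_shift6 (t := t)); rewrite e ?add0r.
Qed.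

Lemma odd_classes_distinct W i j : (i < j < 3)%N ->
  ~ weq (nth W odd_classes i) (nth W odd_classes j).
Proof.
move=> hij.
have : (i = 0 /\ j = 1 \/ i = 0 /\ j = 2 \/ i = 1 /\ j = 2)%N by lia.
case=> [[-> ->]|[[-> ->]|[-> ->]]] /= /(weq_supersingularE F2)
  [u [s [t [u0 e3 e4 e6]]]]; move: e3; rewrite mulr1 => /cube1 u1; subst u.
- by move: e4; rewrite expr1n mul1r add0r => /not_quartic.
- by move: e4; rewrite expr1n mul1r add0r => /not_quartic.
- have : s ^+ 4 + 1 * s = 0.
    move: e4; rewrite expr1n mulr1 => /esym/(congr1 (+%R^~ (-1))).
    by rewrite addrAC subrr add0r.
  move=> /quartic_eq0 [s0|/cube1 s1]; apply: (not_AS (t := t)).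
    by move: e6; rewrite s0 expr1n => e6; rewrite -[LHS]mulr1 e6; ring.
  move: e6; rewrite s1 !expr1n mulr1 => e6; rewrite [LHS]e6.
  by apply: (@eq_mod2 _ F2 _ _ 1); ring.
Qed.

End OddDegree.

Section EvenDegree.
Variables (z w v c v1 v2 : F).
Hypothesis hz : z ^+ 2 + z + 1 = 0.
Hypothesis hw : forall s, w <> s ^+ 4 + 1 * s.
Hypothesis hv : forall t, v <> t ^+ 2 + 1 * t.
Hypothesis c0 : c != 0.
Hypothesis c_noncube : forall u, u ^+ 3 <> c.
Hypothesis c_gen : forall a, a != 0 ->
  exists u i, [/\ u != 0, (i < 3)%N & a = u ^+ 3 * c ^+ i].
Hypothesis hv1 : forall t, v1 <> t ^+ 2 + c * t.
Hypothesis hv2 : forall t, v2 <> t ^+ 2 + c ^+ 2 * t.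

(** The parameter a runs through the classes 1, c, c^2 modulo cubes.  The elements
    v, v1, v2 are to lie outside the images of t^2 + a t for the three values of a,
    and w outside the image of s^4 + s. *)
Definition even_classes : seq (weierstrass F) :=
  [:: SS 1 0 0; SS 1 0 v; SS 1 w 0; SS c 0 0; SS c 0 v1; SS (c ^+ 2) 0 0;
      SS (c ^+ 2) 0 v2].

Let z2 : z ^+ 2 = z + 1.
Proof.
have := hz; rewrite -addrA => /(addr_eq_pchar2 F2); by rewrite add0r.
Qed.

Let z3 : z ^+ 3 = 1.
Proof. by apply: (@eq_mod2 _ F2 _ _ z); ring: z2. Qed.

Let z0 : z != 0.
Proof.
by apply/eqP => e; have := oner_neq0 F; rewrite -z3 e expr0n eqxx.
Qed.

Let AS_one : 1 = z ^+ 2 + 1 * z.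
Proof. by apply: (@eq_mod2 _ F2 _ _ (- z)); ring: z2. Qed.

(** Otherwise both w and z w have the form t^2 + t, say w = x^2 + x and
    z w = t^2 + t; then x itself is the value of that map at t + z^2 x, so w is
    in the image of the square of this map, which is s^4 + s. *)
Let exists_twist : exists s, s ^+ 3 = 1 /\ forall t, s ^+ 2 * w <> t ^+ 2 + 1 * t.
Proof.
have [/existsP [x /eqP hx]|/existsPn h] := boolP [exists t, w == t ^+ 2 + 1 * t]; last first.
  by exists 1; rewrite expr1n; split=> // t; rewrite expr1n mul1r; apply/eqP.
(* s = z^2 is chosen because s^2 = z^4 = z. *)
exists (z ^+ 2); split=> [|t].
  by rewrite -exprM mulnC exprM z3 expr1n.
have -> : (z ^+ 2) ^+ 2 = z by rewrite -exprM -[RHS]mulr1 -z3; ring.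
move=> ht; apply: (hw (s := t + z ^+ 2 * x)); rewrite quartic_sqr [LHS]hx.
suff -> : (t + z ^+ 2 * x) ^+ 2 + 1 * (t + z ^+ 2 * x) = x by [].
rewrite (sqr_addD F2) -ht hx.
have z4 : z ^+ 4 = z by rewrite -[RHS]mulr1 -z3; ring.
by rewrite exprMn -exprM z4; apply: (@eq_mod2 _ F2 _ _ (z * x + z * x ^+ 2)); ring: z2.
Qed.

(** If d is not a cube then s^4 + d s is injective, hence onto, and b can be
    removed. *)
Lemma noncube_cover d y b e : d != 0 -> (forall u, u ^+ 3 <> d) ->
  (forall t, y <> t ^+ 2 + d * t) ->
  weq (SS d b e) (SS d 0 0) \/ weq (SS d b e) (SS d 0 y).
Proof.
move=> d0 nc hy.
have [||k + [s hs]] := additive_cokernel (quartic_addD F2 d) (D := [set 0]) _ _ b.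
- by move=> k l x; rewrite !inE => /eqP-> /eqP->.
- apply: eq_card => x; rewrite !inE; apply/eqP/eqP => [hx|->]; last by ring.
  have /eqP : x * (x ^+ 3 + d) = 0 by rewrite -[RHS]hx; ring.
  by rewrite mulf_eq0 addr_eq0_pchar2 // => /orP[/eqP//|/eqP/nc].
rewrite inE => /eqP k0; subst k.
have [c' hc] := ss_shift4 e hs.
have [t [ht|ht]] := sqr_add_cokernel F2 c' d0 hy; [left|right];
  by apply: weq_trans hc _; apply: (ss_shift6 (t := t)); rewrite ht ?add0r.
Qed.

(** The cokernel of s^4 + s is represented by the multiples of w by elements of
    the field with four elements; scaling by a cube root of unity permutes its nonzero
    ones, so b can be brought to 0 or w.  For b = w, a change with s^3 = 1 given by
    [exists_twist] moves c between the two classes modulo t^2 + t. *)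
Lemma cube_class_cover b e :
  [\/ weq (SS 1 b e) (SS 1 0 0), weq (SS 1 b e) (SS 1 0 v)
    | weq (SS 1 b e) (SS 1 w 0)].
Proof.
(* The kernel of s^4 + s: the field with four elements. *)
pose K4 : {set F} := [set s | s ^+ 4 + 1 * s == 0].
have w0 : w != 0 by apply/eqP => w0; apply: (hw (s := 0)); rewrite w0; ring.
have [||d + [s hs]] := additive_cokernel (quartic_addD F2 1)
    (D := [set k * w | k in K4]) _ _ b.
(* If k w = l w + x^4 + x with k <> l, then m = k + l satisfies m^3 = 1, and w is
   the value of s^4 + s at m^2 x. *)
- move=> _ _ x /imsetP [k hk ->] /imsetP [l hl ->] hx.
  have : k + l \in K4.
    by move: hk hl; rewrite !inE (quartic_addD F2) => /eqP-> /eqP->; rewrite addr0.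
  rewrite inE => /eqP/quartic_eq0 [/eqP|h3].
    by rewrite addr_eq0_pchar2 // => /eqP->.
  case: (hw (s := (k + l) ^+ 2 * x)).
  have ekl : (k + l) * w = x ^+ 4 + 1 * x.
    by rewrite mulrDl hx; apply: (@eq_mod2 _ F2 _ _ (l * w)); ring.
  rewrite exprMn -exprM (exprD _ 6 2) (exprM _ 3 2) h3 expr1n.
  transitivity ((k + l) ^+ 2 * ((k + l) * w)); last by rewrite ekl; ring.
  by rewrite mulrA -exprSr h3 mul1r.
- by rewrite card_imset //; apply: mulIf.
have [c' hc] := ss_shift4 e hs.
case/imsetP => k; rewrite inE => /eqP /quartic_eq0 [-> dE|k3 dE]; subst d.
  rewrite mul0r in hc hs *.
  have [t [ht|ht]] := sqr_add_cokernel F2 c' (oner_neq0 F) hv;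
    [constructor 1|constructor 2];
    by apply: weq_trans hc _; apply: (ss_shift6 (t := t)); rewrite ht ?add0r.
have k0 : k != 0.
  by apply/eqP => h; move: k3 (oner_neq0 F); rewrite h expr0n => <-; rewrite eqxx.
constructor 3; apply: weq_trans hc _.
have h1 := @ss_scale k 1 (k * w) c' k0.
have kw : k * w / k ^+ 4 = w by rewrite (exprS k 3) k3 mulr1 mulrC mulKf.
rewrite k3 mulr1 kw in h1; apply: weq_trans h1 _.
move: (c' / k ^+ 6) => e'.
have [t [ht|ht]] := sqr_add_cokernel F2 e' (oner_neq0 F) hv.
  by apply: (ss_shift6 (t := t)); rewrite ht add0r.
have [y [y3 hy]] := exists_twist.
have [t2 [ht2|ht2]] := sqr_add_cokernel F2 (y ^+ 2 * w) (oner_neq0 F) hv;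
  first by case: (hy t2).
have y4 : y ^+ 4 + 1 * y = 0 by rewrite (exprS y 3) y3 mulr1 mul1r (addrr_pchar2 F2).
(* Here c is v + t^2 + t, and the change adds y^2 w + 1, that is
   v + t2^2 + t2 + (z^2 + z). *)
apply: weq_trans (ss_stab _ _ y4) _; apply: (ss_shift6 (t := t + t2 + z)).
rewrite !(sqr_addD F2) -AS_one ht ht2 (exprM y 3 2) y3 expr1n.
by apply: (@eq_mod2 _ F2 _ _ v); ring.
Qed.

Let c2_noncube u : u ^+ 3 <> c ^+ 2.
Proof.
move=> hu; have u0 : u != 0.
  apply/eqP => u0; move: hu; rewrite u0 expr0n => /esym/eqP.
  by rewrite expf_eq0 (negPf c0).
by apply: (c_noncube (u := c / u)); rewrite expr_div_n hu exprSr mulrC mulKf ?expf_neq0.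
Qed.

Lemma even_classes_cover a b e W : a != 0 ->
  exists i, (i < 7)%N /\ weq (nth W even_classes i) (SS a b e).
Proof.
move=> a0; suff : exists i, (i < 7)%N /\ weq (SS a b e) (nth W even_classes i).
  by move=> [i [hi /weq_sym h]]; exists i.
have [u [k [u0 hk ->]]] := c_gen a0.
have := @ss_scale u (c ^+ k) b e u0; move: (b / _) (e / _) => b' e' h.
suff : exists i, (i < 7)%N /\ weq (SS (c ^+ k) b' e') (nth W even_classes i).
  by move=> [i [hi h']]; exists i; split=> //; apply: weq_trans h h'.
case: k hk {h} => [|[|[|//]]] _.
- by have [] := cube_class_cover b' e'; [exists 0%N|exists 1%N|exists 2%N].
- rewrite expr1; by have [] := noncube_cover b' e' c0 c_noncube hv1;
    [exists 3%N|exists 4%N].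
- by have [] := noncube_cover b' e' (expf_neq0 2 c0) c2_noncube hv2;
    [exists 5%N|exists 6%N].
Qed.

Let weq_a a b e a' b' e' : weq (SS a b e) (SS a' b' e') ->
  exists2 u, u != 0 & u ^+ 3 * a' = a.
Proof. by case/(weq_supersingularE F2) => u [s [t [u0 e3 _ _]]]; exists u. Qed.

Let not_weq_1c b e b' e' : ~ weq (SS 1 b e) (SS c b' e').
Proof.
move=> /weq_a [u u0 hu]; apply: (c_noncube (u := u^-1)).
by rewrite exprVn -[LHS]mulr1 -hu mulKf ?expf_neq0.
Qed.

Let not_weq_1c2 b e b' e' : ~ weq (SS 1 b e) (SS (c ^+ 2) b' e').
Proof.
move=> /weq_a [u u0 hu]; apply: (c2_noncube (u := u^-1)).
by rewrite exprVn -[LHS]mulr1 -hu mulKf ?expf_neq0.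
Qed.

Let not_weq_cc2 b e b' e' : ~ weq (SS c b e) (SS (c ^+ 2) b' e').
Proof.
move=> /weq_a [u u0 hu]; apply: (c_noncube (u := u^-1)).
rewrite exprVn -[LHS]mulr1 -(divff c0) -{1}hu.
by rewrite expr2; field; rewrite u0 c0.
Qed.

Let not_weq_v : ~ weq (SS 1 0 0) (SS 1 0 v).
Proof.
case/(weq_supersingularE F2) => u [s [t [u0 e3 e4 e6]]].
rewrite mulr1 in e3; rewrite (exprM u 3 2) e3 expr1n mul1r in e6.
have : s ^+ 4 + 1 * s = 0 by move: e4; rewrite mulr0 add0r.
case/quartic_eq0 => hs.
  by apply: (hv (t := t)); rewrite e6 hs; ring.
apply: (hv (t := t + z)); rewrite (sqr_addD F2) -AS_one e6 (exprM s 3 2) hs.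
by ring.
Qed.

Let not_weq_w e e' : ~ weq (SS 1 0 e) (SS 1 w e').
Proof.
case/(weq_supersingularE F2) => u [s [t [u0 e3 e4 e6]]].
rewrite mulr1 in e3; apply: (hw (s := u ^+ 2 * s)).
have e4' : u * w = s ^+ 4 + 1 * s.
  by rewrite add0r in e4; rewrite -e4 (exprSr u 3) e3 mul1r.
rewrite exprMn -exprM (exprD u 6 2) (exprM u 3 2) e3 expr1n.
transitivity (u ^+ 2 * (u * w)); last by rewrite e4'; ring.
by rewrite mulrA -exprSr e3 mul1r.
Qed.

Let not_weq_noncube d y : (forall u, u ^+ 3 <> d) ->
  (forall t, y <> t ^+ 2 + d * t) -> ~ weq (SS d 0 0) (SS d 0 y).
Proof.
move=> nd hy; case/(weq_supersingularE F2) => u [s [t [u0 e3 e4 e6]]].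
have d0 : d != 0 by apply/eqP => d0; apply: (nd 0); rewrite d0 expr0n.
have u3 : u ^+ 3 = 1 by apply: (mulIf d0); rewrite e3 mul1r.
have /eqP : s * (s ^+ 3 + d) = 0.
  by move: e4; rewrite mulr0 add0r => e4; rewrite [RHS]e4; ring.
rewrite mulf_eq0 addr_eq0_pchar2 // => /orP[/eqP s0|/eqP/nd//].
rewrite (exprM u 3 2) u3 expr1n mul1r in e6.
by apply: (hy t); rewrite e6 s0; ring.
Qed.

Lemma even_classes_distinct W i j : (i < j < 7)%N ->
  ~ weq (nth W even_classes i) (nth W even_classes j).
Proof.
case/andP=> ij j7; move: j j7 ij => [|[|[|[|[|[|[|//]]]]]]] _;
  move: i => [|[|[|[|[|[|//]]]]]] //= _;
  first [ exact: not_weq_1c | exact: not_weq_1c2 | exact: not_weq_cc2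
        | exact: not_weq_v | exact: not_weq_w | exact: not_weq_noncube].
Qed.

End EvenDegree.

End SupersingularClasses.

(** * Counting the twists *)

Section CountingTwists.
Local Open Scope ring_scope.
Local Open Scope card_scope.
Variables (F : finFieldType) (Fbar : fieldType) (iota : {rmorphism F -> Fbar}).
Hypothesis closedF : forall p : {poly Fbar}, (1 < size p)%N -> exists x, root p x.
Implicit Types E : elliptic_curve F.

Lemma is_twistP E E' :
  is_twist iota E E' <-> weq (map_weierstrass iota E) (map_weierstrass iota E').
Proof. exact: isomorphicP. Qed.

(** It suffices to exhibit k inequivalent curves that represent all twists. *)
Lemma card_Twist E (k : nat) (R : nat -> weierstrass F) :
  (forall i, (i < k)%N -> disc (R i) != 0) ->
  (forall i, (i < k)%N ->
     weq (map_weierstrass iota E) (map_weierstrass iota (R i))) ->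
  (forall E', weq (map_weierstrass iota E) (map_weierstrass iota E') ->
     exists i, (i < k)%N /\ weq (R i) E') ->
  (forall i j, (i < j < k)%N -> ~ weq (R i) (R j)) ->
  Twist iota E #= `I_k.
Proof.
move=> discR twR coverR distR.
pose C i : elliptic_curve F :=
  if insub i : option 'I_k is Some j then EllipticCurve (discR j (ltn_ord j)) else E.
have CE i : (i < k)%N -> C i = R i :> weierstrass F.
  by move=> hi; rewrite /C insubT.
have -> : Twist iota E = ((fun i => isomorphic iota (C i)) @` `I_k)%classic.
  apply/seteqP; split=> [_ [E' /is_twistP /coverR [i [hi h]] <-]|_ [i hi <-]].
    exists i => //; apply/boolp.funext => E2; apply/boolp.propext.
    rewrite !isomorphicP // CE //; split; first exact: weq_trans (weq_sym h).
    exact: weq_trans.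
  exists (C i) => //; apply/is_twistP; rewrite CE //; exact: twR.
apply: inj_card_eq => i j /set_mem /= hi /set_mem /= hj e.
have h : weq (R i) (R j).
  rewrite -!CE //; apply/(isomorphicP iota closedF); rewrite e.
  by apply/isomorphicP => //; apply: weq_refl.
have [lt|lt|//] := ltngtP i j.
  by case: (distR i j _ h); rewrite lt.
by case: (distR j i _ (weq_sym h)); rewrite lt.
Qed.

Hypothesis F2 : 2 \in [pchar F].

Let Fbar2 : 2 \in [pchar Fbar].
Proof. by rewrite (fmorph_pchar iota). Qed.

Lemma weq_a1_eq0 (W W' : weierstrass F) :
  weq (map_weierstrass iota W) (map_weierstrass iota W') -> (a1 W == 0) = (a1 W' == 0).
Proof.
move=> [u [r [s [t [u0 /(change_pchar2 Fbar2) [/= e _ _ _ _]]]]]].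
by rewrite -(fmorph_eq0 iota) -e mulf_eq0 (negPf u0) fmorph_eq0.
Qed.

Lemma map_ordinary x y : map_weierstrass iota (ordinary x y) = ordinary (iota x) (iota y).
Proof. by rewrite /map_weierstrass /= rmorph0 rmorph1. Qed.

Lemma map_supersingular a b c :
  map_weierstrass iota (supersingular a b c) = supersingular (iota a) (iota b) (iota c).
Proof. by rewrite /map_weierstrass /= rmorph0. Qed.

(** Over the closure, all ordinary curves with the same last coefficient are
    equivalent; over F they are told apart by the class of the other one modulo
    s^2 + s, a subgroup of index 2. *)
Lemma card_Twist_ordinary E : a1 E != 0 -> Twist iota E #= `I_2.
Proof.
move=> h1; have [x [y hE]] := weq_ordinary F2 h1.
have y0 : y != 0 by rewrite -(disc_ordinary F2 x y) (weq_disc hE) ?disc_neq0.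
have [w hw] := sqr_add_not_onto F2 (oner_neq0 F).
apply: (@card_Twist E 2 (fun i => ordinary (nth 0 [:: x; x + w] i) y)).
- by move=> i _; rewrite disc_ordinary.
- move=> i _; apply: weq_trans (weq_map iota hE) _; rewrite !map_ordinary.
  exact: weq_ordinary_closed.
- move=> E' hE'; have h1' : a1 E' != 0 by rewrite -(weq_a1_eq0 hE').
  have [x' [y' hE2]] := weq_ordinary F2 h1'.
  have : weq (ordinary (iota x) (iota y)) (ordinary (iota x') (iota y')).
    rewrite -!map_ordinary; apply: weq_trans (weq_sym (weq_map iota hE)) _.
    exact: weq_trans hE' (weq_map iota hE2).
  case/(weq_ordinaryE Fbar2) => /fmorph_inj yy' _; subst y'.
  have [t ht] := sqr_add_cokernel F2 (x' - x) (oner_neq0 F) hw.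
  suff [i [hi h]] : exists i, (i < 2)%N /\
      weq (ordinary (nth 0 [:: x; x + w] i) y) (ordinary x' y).
    by exists i; split=> //; apply: weq_trans h (weq_sym hE2).
  case: ht => ht; [exists 0%N|exists 1%N]; split=> //=;
    apply/(weq_ordinaryE F2); split=> //; exists t;
    rewrite -[LHS](subrK x) ht; ring.
- move=> i j hij; have [-> ->] : i = 0%N /\ j = 1%N by lia.
  move=> /= /(weq_ordinaryE F2) [_ [s /addrI hs]].
  by apply: (hw s); rewrite hs; ring.
Qed.

(** Over the closure all curves with a1 = 0 are equivalent, so a system of
    representatives of the equation classes over F counts the twists. *)
Lemma card_Twist_supersingular E (k : nat) (R : seq (weierstrass F))
    (dflt : weierstrass F) :
  a1 E = 0 ->
  (forall i, (i < k)%N -> a1 (nth dflt R i) = 0 /\ a3 (nth dflt R i) != 0) ->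
  (forall a b c, a != 0 ->
     exists i, (i < k)%N /\ weq (nth dflt R i) (supersingular a b c)) ->
  (forall i j, (i < j < k)%N -> ~ weq (nth dflt R i) (nth dflt R j)) ->
  Twist iota E #= `I_k.
Proof.
move=> h1 hR cover dist.
have normal (W : weierstrass F) : disc W != 0 -> a1 W = 0 -> exists a b c,
    a != 0 /\ weq W (supersingular a b c).
  move=> dW aW; have [a [b [c h]]] := weq_supersingular F2 aW.
  exists a, b, c; split=> //; have := weq_disc h dW.
  by rewrite disc_supersingular // expf_eq0.
have hRd i : (i < k)%N -> disc (nth dflt R i) != 0.
  move=> /hR [r1 r3]; suff -> : disc (nth dflt R i) = a3 (nth dflt R i) ^+ 4 by rewrite expf_neq0.
  by rewrite disc_pchar2 // r1; ring.
have [a [b [c [a0 hE]]]] := normal E (disc_neq0 E) h1.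
apply: (@card_Twist E k (fun i => nth dflt R i)) => //.
- move=> i hi; have [a' [b' [c' [a0' hRi]]]] := normal _ (hRd i hi) (hR i hi).1.
  apply: weq_trans (weq_map iota hE) (weq_trans _ (weq_sym (weq_map iota hRi))).
  rewrite !map_supersingular.
  by apply: (weq_supersingular_closed Fbar2 closedF); rewrite fmorph_eq0.
- move=> E' hE'; have h1' : a1 E' = 0 by apply/eqP; rewrite -(weq_a1_eq0 hE') h1.
  have [a' [b' [c' [a0' hE2]]]] := normal _ (disc_neq0 E') h1'.
  have [i [hi h]] := cover a' b' c' a0'.
  by exists i; split=> //; apply: weq_trans h (weq_sym hE2).
Qed.

End CountingTwists.

Local Open Scope card_scope.

Theorem proposition3p2 (n : nat) (F : finFieldType) (Fbar : fieldType)
    (iota : {rmorphism F -> Fbar}) (E : elliptic_curve F)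
    (hn : (1 <= n)%N) (hF : #|F| = (2 ^ n)%N)
    (hFbar : separable_closure iota) :
  Twist iota E #=
    `I_(if (j_invariant E != 0)%R then 2 else if odd n then 3 else 7).
Proof.
have closedF := separable_closure_closed hFbar.
have F2 : 2 \in [pchar F]%R.
  exact: card_finPcharP hF isT.
rewrite j_invariant_eq0 //; case: ifPn => [|/negPn/eqP h1].
  exact: card_Twist_ordinary.
case: ifPn => on.
  have noz := cube_root_unity_odd F2 hF on.
  apply: (@card_Twist_supersingular _ _ _ closedF F2 E 3 (odd_classes F) E h1).
  - by move=> [|[|[|//]]] _; split=> //=; exact: oner_neq0.
  - move=> a b c a0; have [i [hi h]] := odd_classes_cover F2 noz b c a0.
    exists i; split=> //; by rewrite (set_nth_default (supersingular a b c)).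
  - exact: odd_classes_distinct.
have [z hz] := cube_root_unity_even F2 hF on.
have [c [nc gc]] := exists_noncube F2 hz.
have c0 : (c != 0)%R by apply/eqP => c0; apply: (nc 0%R); rewrite c0 expr0n.
have c20 : (c ^+ 2 != 0)%R by rewrite expf_neq0.
have [v hv] := sqr_add_not_onto F2 (oner_neq0 F).
have [v1 hv1] := sqr_add_not_onto F2 c0.
have [v2 hv2] := sqr_add_not_onto F2 c20.
have [w hw] : exists w : F, forall s, w <> (s ^+ 4 + 1 * s)%R.
  apply: (@not_injective_not_onto _ (fun s : F => s ^+ 4 + 1 * s)%R 0%R 1%R).
    by rewrite eq_sym oner_neq0.
  by apply: (@eq_mod2 _ F2 _ _ (-1)%R); ring.
apply: (@card_Twist_supersingular _ _ _ closedF F2 E 7 (even_classes w v c v1 v2) E h1).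
- by move=> [|[|[|[|[|[|[|//]]]]]]] _; split=> //=; exact: oner_neq0.
- by move=> a b e a0; apply: (even_classes_cover F2 hz).
- exact: (even_classes_distinct F2 hz).
Qed.
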